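(* Let $\alpha(x)$ be a sub-polynomial with $\lim_{x\to+\infty}\alpha(x)=+\infty$ of the form $$\alpha(x)=\gamma x+\lambda\log(x)+r_1(x),$$ for some $\gamma\geq0$, $\lambda\in\mathbb{R}$, and $r_1(x)$ with $\lim_{x\to+\infty}\frac{|r_1(x)|}{\log x}=0$. For $t\in\mathbb{R}$ let $[\![t]\!]:=\lfloor t+\frac12\rfloor$ and $\|t\|:=|t-[\![t]\!]|$ (the distance to the nearest integer). Then the following are equivalent: (1) For all $A\subseteq\mathbb{N}$ such that $\overline{d}(A)>0$, there exist $x,y\in A$ and $n\in\mathbb{N}$ such that $x+y=[\![\alpha(n)]\!]$. (2) One of the following is true: (a) $\gamma\leq1$. (b) For some odd $a\in\mathbb{N}$ and some $c\in\mathbb{Z}$, we have, for all sufficiently large $n\in\mathbb{N}$, $$[\![\alpha(n)]\!]=n+\left[\!\left[\frac{n+c}{a}\right]\!\right],$$ and the set $\mathbb{N}\setminus\{[\![\alpha(n)]\!]:n\in\mathbb{N}\}$ contains only finitely many even integers. (c) $\lim_{x\to+\infty}\left|\lambda\log(x)+r_1(x)\right|=+\infty$, $\ 1<\gamma\leq2$, and $$\left\|\frac{\lambda\log(2)}{\gamma}\right\|\geq1-\frac1\gamma.$$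
   Context: $\mathbb{N}=\{1,2,\dots\}$. For $A\subseteq\mathbb{N}$, $\overline{d}(A)=\limsup_{N\to\infty}\frac{|A\cap[1,N]|}{N}$. Let $\mathcal{G}$ be the ring (under pointwise addition and multiplication) of germs at $+\infty$ of continuous real-valued functions defined on half-lines $(a,+\infty)$; two functions have the same germ if they agree for all sufficiently large $x$. A Hardy field is a subfield of $\mathcal{G}$ closed under differentiation (each element is eventually differentiable and its derivative's germ lies in the field). A sub-polynomial is a function $\alpha$ whose germ belongs to some Hardy field and which satisfies $\lim_{x\to+\infty}\alpha(x)/x^l=0$ for some $l>0$. Functions and germs are not distinguished; when values $\alpha(n)$, $n\in\mathbb{N}$, appear, $\alpha$ denotes a fixed real-valued representative defined on $[1,+\infty)$. *)

(* Defs.v *)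
From HB Require Import structures.
From mathcomp Require Import all_boot all_order all_algebra.
From mathcomp Require Import finmap.
From mathcomp Require Import all_classical all_reals all_analysis.

Set Implicit Arguments.
Unset Strict Implicit.
Unset Printing Implicit Defensive.

Import Order.TTheory GRing.Theory Num.Theory.
Import numFieldNormedType.Exports.

Local Open Scope classical_set_scope.
Local Open Scope ring_scope.

(* N = {1, 2, ...} *)
Definition posnat : set nat := [set n | (0 < n)%N].

(* The term at N = 0 is irrelevant to the limit superior. *)
Definition upper_density (R : realType) (A : set nat) : \bar R :=
  limn_esup (fun N : nat =>
    (#|` fset_set (A `&` [set k | (1 <= k <= N)%N])|%:R / N%:R)%:E).

(* Germs at +oo are represented by total functions R -> R up to [germ_eq]; a
   set of germs is represented by a set of functions saturated for [germ_eq]. *)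
Definition germ_eq (R : realType) (f g : R -> R) : Prop :=
  \forall x \near +oo, f x = g x.

Definition continuous_on_half_line (R : realType) (f : R -> R) : Prop :=
  exists a : R, forall x : R, a < x -> {for x, continuous f}.

Record hardy_field (R : realType) (H : set (R -> R)) : Prop := HardyField {
  hardy_germ : forall f g, H f -> germ_eq f g -> H g;
  hardy_continuous : forall f, H f -> continuous_on_half_line f;
  hardy_one : H (fun=> 1);
  hardy_sub : forall f g, H f -> H g -> H (fun x => f x - g x);
  hardy_mul : forall f g, H f -> H g -> H (fun x => f x * g x);
  hardy_inv : forall f, H f -> ~ germ_eq f (fun=> 0) ->
    exists2 g, H g & germ_eq (fun x => f x * g x) (fun=> 1);
  hardy_derivable : forall f, H f -> \forall x \near +oo, derivable f x 1;
  hardy_derive : forall f, H f -> H (derive1 f)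
}.

Definition sub_polynomial (R : realType) (alpha : R -> R) : Prop :=
  (exists2 H : set (R -> R), hardy_field H & H alpha) /\
  (exists2 l : R, 0 < l & alpha x / x `^ l @[x --> +oo] --> 0).

Definition nearest_int (R : realType) (t : R) : int := Num.floor (t + 1 / 2).

Definition dist_int (R : realType) (t : R) : R := `|t - (nearest_int t)%:~R|.

(* Main.v *)
(** Write [alpha x = gamma x + g x]. Quotients of elements of a Hardy field
are eventually monotone, which suffices to show that [x g'(x)] tends to
[lambda], so that [g (c x) = g x + lambda ln c + o(1)]. Hence, for
[gamma > 1], a large [m] is of the form [[alpha n]] essentially when its phase
[(m - g m + lambda ln gamma) / gamma] is at distance at most [1 / (2 gamma)]
from the integers.

If [x] and [y] have the same order of magnitude [N], the phase of [x + y]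
involves [g N + lambda ln 2]; if [y] is much smaller than [x], it involves
[g N] only. Both phases can avoid the integers when
[d = lambda ln 2 / gamma] satisfies [||d|| < 1 - 1 / gamma], and a Bohr set
restricted to sparse windows then has no attained sum. Otherwise they can avoid
them only if [||d|| = 1 - 1 / gamma], in which case [4 x / gamma - 2 g x / gamma]
converges modulo [1] along the set; this is impossible for positive upper
density, because [lambda <> 0].

If [g] is bounded and [gamma] is irrational, a Bohr set again has no attained
sum. If [gamma = p / q], the attained integers are eventually a union of [q]
residue classes modulo [p], and they meet all [2 u] modulo [p] only in the
situation of (b). *)

Require Import Defs.
From HB Require Import structures.
From mathcomp Require Import all_boot all_order all_algebra.
From mathcomp Require Import finmap.
From mathcomp Require Import all_classical all_reals all_analysis.
From mathcomp Require Import ring lra zify.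

Set Implicit Arguments.
Unset Strict Implicit.
Unset Printing Implicit Defensive.

Import Order.TTheory GRing.Theory Num.Theory.
Import numFieldNormedType.Exports.

Local Open Scope classical_set_scope.
Local Open Scope ring_scope.

(** * Signs of germs in a Hardy field *)

(** The Hardy field containing [alpha] need not contain [x], [ln], [gamma] or [lambda], so the sign
    of [x (alpha' - gamma) - e] does not follow from membership. It is obtained by dividing and
    differentiating until [x] and [e] have disappeared and [gamma] occurs linearly over the field.

    The phase of a missed integer lies, up to [o(1)], in the arc of length [1 - 1 / gamma] centred
    at [1/2]. Two points that differ by [d] fit into its interior exactly when
    [||d|| < 1 - 1 / gamma], which is the origin of the bound in (c). At equality they must sit at
    the two ends, and this pins the phase along the set. To contradict positive density, take a
    difference [h] that recurs arbitrarily far out in the set: pinning makes [4 h / gamma] an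
    integer, so multiplication by [h] removes the linear term modulo [1] and leaves [2 h g / gamma],
    which moves like a logarithm. *)

Definition eventually_signed (R : realType) (f : R -> R) : Prop :=
  [\/ \forall x \near +oo, f x = 0, \forall x \near +oo, 0 < f x
    | \forall x \near +oo, f x < 0].

Lemma near_pinftyP (R : realType) (P : R -> Prop) :
  (\forall x \near +oo, P x) <-> (exists X : R, forall x, X <= x -> P x).
Proof.
split=> [[X [_ HX]]|[X HX]].
  by exists (X + 1) => x Xx; apply: HX; rewrite (lt_le_trans _ Xx)// ltrDl.
by exists X; split=> [|x Xx]; [exact: num_real|apply: HX; exact: ltW].
Qed.

Lemma derive_nonneg_nondecreasing (R : realType) (f f' : R -> R) (X : R) :
  (forall x, X <= x -> is_derive x 1 f (f' x)) ->
  (forall x, X <= x -> 0 <= f' x) ->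
  forall x y, X <= x -> x <= y -> f x <= f y.
Proof.
move=> df f'0 x y Xx xy.
have [||c] := @MVT_segment R f f' x y xy.
- by move=> z /[!in_itv]/= /andP[xz _]; apply: df; apply: le_trans Xx (ltW xz).
- apply: derivable_within_continuous => z /[!in_itv]/= /andP[xz _].
  by apply: ex_derive; apply: df; apply: le_trans xz.
rewrite in_itv/= => /andP[xc _] e; rewrite -subr_ge0 e mulr_ge0 ?subr_ge0//.
by apply: f'0; apply: le_trans xc.
Qed.

Lemma nondecreasing_eventually_signed (R : realType) (f : R -> R) (X : R) :
  (forall x y, X <= x -> x <= y -> f x <= f y) -> eventually_signed f.
Proof.
move=> ndf.
have [[x [Xx fx]]|fle0] := pselect (exists x, X <= x /\ 0 < f x).
  apply: Or32; apply/near_pinftyP; exists x => y xy.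
  exact: lt_le_trans fx (ndf _ _ Xx xy).
have {}fle0 x : X <= x -> f x <= 0.
  by move=> Xx; rewrite leNgt; apply/negP => fx; apply: fle0; exists x.
have [[x [Xx fx]]|fneq0] := pselect (exists x, X <= x /\ 0 = f x).
  apply: Or31; apply/near_pinftyP; exists x => y xy; apply/eqP.
  by rewrite eq_le fle0 ?(le_trans Xx)//= fx ndf.
apply: Or33; apply/near_pinftyP; exists X => x Xx; rewrite lt_neqAle fle0// andbT.
by apply/eqP => fx; apply: fneq0; exists x.
Qed.

Lemma eventually_signedN (R : realType) (f : R -> R) :
  eventually_signed (fun x => - f x) -> eventually_signed f.
Proof.
case=> h; [apply: Or31|apply: Or33|apply: Or32]; apply: filterS h => x.
- by move/eqP; rewrite oppr_eq0 => /eqP.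
- by rewrite oppr_gt0.
- by rewrite oppr_lt0.
Qed.

Lemma eq_eventually_signed (R : realType) (f g : R -> R) :
  germ_eq f g -> eventually_signed f -> eventually_signed g.
Proof.
by move=> fg [] h; [apply: Or31|apply: Or32|apply: Or33];
  apply: filterS2 fg h => x ->.
Qed.

Lemma eventually_signedM (R : realType) (f g : R -> R) :
  eventually_signed f -> eventually_signed g ->
  eventually_signed (fun x => f x * g x).
Proof.
case=> hf [] hg.
- by apply: Or31; apply: filterS hf => x ->; rewrite mul0r.
- by apply: Or31; apply: filterS hf => x ->; rewrite mul0r.
- by apply: Or31; apply: filterS hf => x ->; rewrite mul0r.
- by apply: Or31; apply: filterS hg => x ->; rewrite mulr0.
- by apply: Or32; apply: filterS2 hf hg => x f0 g0; rewrite mulr_gt0.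
- by apply: Or33; apply: filterS2 hf hg => x f0 g0; rewrite pmulr_rlt0.
- by apply: Or31; apply: filterS hg => x ->; rewrite mulr0.
- by apply: Or33; apply: filterS2 hf hg => x f0 g0; rewrite nmulr_rlt0.
- by apply: Or32; apply: filterS2 hf hg => x f0 g0; rewrite nmulr_rgt0.
Qed.

Lemma eventually_monotone (R : realType) (f f' : R -> R) :
  (\forall x \near +oo, is_derive (x : R) 1 f (f' x)) -> eventually_signed f' ->
  (exists X : R, forall x y, X <= x -> x <= y -> f x <= f y) \/
  (exists X : R, forall x y, X <= x -> x <= y -> f y <= f x).
Proof.
have pos (h h' : R -> R) : (\forall x \near +oo, is_derive (x : R) 1 h (h' x)) ->
    (\forall x \near +oo, 0 <= h' x) ->
    exists X : R, forall x y, X <= x -> x <= y -> h x <= h y.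
  move=> /near_pinftyP[X HX] /near_pinftyP[Y HY]; exists (Num.max X Y).
  by apply: (@derive_nonneg_nondecreasing _ _ h') => x;
    rewrite ge_max => /andP[/HX + /HY].
move=> df [] h.
- by left; apply: pos df _; apply: filterS h => x ->.
- by left; apply: pos df _; apply: filterS h => x /ltW.
- right; have [||X HX] := pos (fun x => - f x) (fun x => - f' x).
  + by apply: filterS df => x dfx; apply: is_deriveN.
  + by apply: filterS h => x /ltW; rewrite oppr_ge0.
  + by exists X => x y Xx xy; rewrite -lerN2 HX.
Qed.

Lemma eventually_signed_of_derive (R : realType) (f f' : R -> R) :
  (\forall x \near +oo, is_derive (x : R) 1 f (f' x)) ->
  eventually_signed f' -> eventually_signed f.
Proof.
move=> df /(eventually_monotone df)[] [X HX].
  exact: nondecreasing_eventually_signed HX.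
apply/eventually_signedN/(@nondecreasing_eventually_signed _ _ X) => x y Xx xy.
by rewrite lerN2 HX.
Qed.

Lemma continuous_nonvanishing_sign (R : realType) (f : R -> R) (a : R) :
  (forall x, a < x -> {for x, continuous f}) -> (forall x, a < x -> f x != 0) ->
  (forall x, a < x -> 0 < f x) \/ (forall x, a < x -> f x < 0).
Proof.
move=> cf f0.
have [[u [au fu]]|npos] := pselect (exists u, a < u /\ 0 < f u); last first.
  right=> x ax; rewrite lt_neqAle f0//= leNgt; apply/negP => fx.
  by apply: npos; exists x.
left=> x ax; rewrite lt_neqAle eq_sym f0//= leNgt; apply/negP => fx.
have ivt (p q : R) : a < p -> a < q -> p <= q ->
    Num.min (f p) (f q) <= 0 <= Num.max (f p) (f q) -> False.
  move=> ap aq pq /(IVT pq)[].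
    apply: continuous_in_subspaceT => z /[!inE]/= /[!in_itv]/= /andP[pz _].
    by apply: cf; apply: lt_le_trans pz.
  move=> c /[!in_itv]/= /andP[pc _] fc0.
  by have := f0 c (lt_le_trans ap pc); rewrite fc0 eqxx.
have [ux|xu] := leP u x; [apply: (ivt u x)|apply: (ivt x u)] => //;
  rewrite ?(ltW xu)// ge_min le_max ?(ltW fu) ?(ltW fx) ?orbT//.
Qed.

(** A germ other than zero is invertible in the field, hence has no zeros far out; by continuity it
    then keeps one sign. *)
Lemma hardy_eventually_signed (R : realType) (H : set (R -> R)) (f : R -> R) :
  hardy_field H -> H f -> eventually_signed f.
Proof.
move=> HH Hf; have [f0|fN0] := pselect (germ_eq f (fun=> 0)).
  exact: Or31.
have [g Hg] := hardy_inv HH Hf fN0; rewrite /germ_eq.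
move=> /near_pinftyP[X HX]; have [a ca] := hardy_continuous HH Hf.
pose b := Num.max a X.
have [||s|s] := @continuous_nonvanishing_sign _ f b.
- by move=> x; rewrite gt_max => /andP[ax _]; exact: ca.
- move=> x; rewrite gt_max => /andP[_ Xx]; apply/eqP => fx0.
  by have /eqP := HX _ (ltW Xx); rewrite fx0 mul0r eq_sym oner_eq0.
- by apply: Or32; exists b; split=> //; exact: num_real.
- by apply: Or33; exists b; split=> //; exact: num_real.
Qed.

Section HardyOperations.
Context (R : realType) (H : set (R -> R)) (HH : hardy_field H).

Lemma hardy_zero : H (fun=> 0).
Proof.
have := hardy_sub HH (hardy_one HH) (hardy_one HH).
by move/(hardy_germ HH); apply; near=> x; rewrite subrr.
Unshelve. all: by end_near. Qed.

Lemma hardy_add (f g : R -> R) : H f -> H g -> H (fun x => f x + g x).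
Proof.
move=> Hf Hg; have := hardy_sub HH Hf (hardy_sub HH hardy_zero Hg).
by move/(hardy_germ HH); apply; near=> x; rewrite sub0r opprK.
Unshelve. all: by end_near. Qed.

Lemma hardy_is_derive (f : R -> R) : H f ->
  \forall x \near +oo, is_derive (x : R) 1 f (derive1 f x).
Proof.
move=> Hf; apply: filterS (hardy_derivable HH Hf) => x dfx.
by apply: DeriveDef => //; rewrite derive1E.
Qed.

(* A real constant [c] need not belong to [H]; the quotient [p / r] does, and
   being monotone it is eventually on one side of [- c]. *)
Lemma hardy_linear_eventually_signed (p r : R -> R) (c : R) : H p -> H r ->
  eventually_signed (fun x => p x + c * r x).
Proof.
move=> Hp Hr; have [r0|rN0] := pselect (germ_eq r (fun=> 0)).
  apply: (eq_eventually_signed (f := p)); last exact: hardy_eventually_signed HH Hp.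
  by apply: filterS r0 => x ->; rewrite mulr0 addr0.
have [w Hw rw] := hardy_inv HH Hr rN0; have Hpw := hardy_mul HH Hp Hw.
have s : eventually_signed (fun x => p x * w x + c).
  apply: (eventually_signed_of_derive (f' := derive1 (fun x => p x * w x))).
    apply: filterS (hardy_is_derive Hpw) => x d.
    by rewrite -[derive1 _ x]addr0; apply: is_deriveD.
  exact: hardy_eventually_signed HH (hardy_derive HH Hpw).
apply: eq_eventually_signed
  (eventually_signedM (hardy_eventually_signed HH Hr) s).
by apply: filterS rw => x e; rewrite mulrDr mulrCA e mulr1 mulrC [c * _]mulrC.
Qed.

(* With [f'] and [f''] in [H], [f' - c + x f''] is the derivative of
   [x (f' - c)], and dividing it by [f''] gives
   [P = f' / f'' - c / f'' + x], whose derivative is linear in [c] over [H]. *)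
Lemma hardy_mulX_eventually_signed (f : R -> R) (c e : R) : H f ->
  eventually_signed (fun x => x * (f x - c) - e).
Proof.
move=> Hf; have Hf' := hardy_derive HH Hf.
apply: (eventually_signed_of_derive
  (f' := fun x => (f x - c) + x * derive1 f x)).
  apply: filterS (hardy_is_derive Hf) => x df.
  have h1 : is_derive x 1 (fun y => f y - c) (derive1 f x).
    by rewrite -[derive1 _ x]subr0; apply: is_deriveB.
  have h2 := is_deriveM (is_derive_id x 1) h1.
  have h3 := is_deriveB h2 (is_derive_cst e x 1).
  apply: is_derive_eq h3 _.
  by rewrite subr0 /GRing.scale/= mulr1 addrC.
have [f'0|f'N0] := pselect (germ_eq (derive1 f) (fun=> 0)).
  apply: (eq_eventually_signed (f := fun x => f x + (- c) * 1)).
    by apply: filterS f'0 => x ->; rewrite mulr1 mulr0 addr0.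
  exact: hardy_linear_eventually_signed Hf (hardy_one HH).
have [w Hw f'w] := hardy_inv HH Hf' f'N0; have Hfw := hardy_mul HH Hf Hw.
pose p x := f x * w x - c * w x + x.
have sp : eventually_signed p.
  apply: (eventually_signed_of_derive
    (f' := fun x => (derive1 (fun x => f x * w x) x + 1) + (- c) * derive1 w x)).
    apply: filterS2 (hardy_is_derive Hfw) (hardy_is_derive Hw) => x d1 d2.
    have h := is_deriveD (is_deriveB d1 (is_deriveZ c d2)) (is_derive_id x 1).
    by apply: is_derive_eq h _; rewrite /GRing.scale/= mulNr addrAC.
  apply: hardy_linear_eventually_signed (hardy_derive HH Hw).
  by apply: hardy_add (hardy_one HH); apply: hardy_derive.
apply: eq_eventually_signed
  (eventually_signedM (hardy_eventually_signed HH Hf') sp).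
by apply: filterS f'w => x e1; rewrite /p; ring: e1.
Qed.

End HardyOperations.

(** * Logarithmic slope of the remainder *)

(** The integrated form of [x g'(x) -> lambda]. It mentions no derivative, and the error is
    proportional to the increment of [ln], so that it serves for close and for distant points
    alike. *)
Definition log_slope (R : realType) (g : R -> R) (lambda : R) : Prop :=
  forall eps : R, 0 < eps -> exists2 X : R, 0 < X & forall x y : R,
    X <= x -> x <= y ->
    `|g y - g x - lambda * (ln y - ln x)| <= eps * (ln y - ln x).

(** If [x g'(x) >= c] far out, then [g - c ln] is nondecreasing there, so [g] grows at least like
    [c ln x]; this contradicts [g = lambda ln + o(ln)] with [lambda < c]. *)
Lemma log_growth_derive_bound (R : realType) (g g' r : R -> R) (lambda c : R) :
  (\forall x \near +oo, is_derive (x : R) (1 : R) g (g' x)) ->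
  (\forall x \near +oo, g x = lambda * ln x + r x) ->
  `|r x| / ln x @[x --> +oo] --> 0 ->
  lambda < c -> ~ (\forall x \near +oo, c <= x * g' x).
Proof.
move=> /near_pinftyP[X1 dg] /near_pinftyP[X2 gE] r0 lc /near_pinftyP[X3 cg'].
have e0 : 0 < (c - lambda) / 2 by lra.
move/cvgr0Pnorm_le: r0 => /(_ _ e0) /near_pinftyP[X4 rle].
pose X := Num.max 1 (Num.max (Num.max X1 X2) (Num.max X3 X4)).
have XP x : X <= x -> [/\ 1 <= x, X1 <= x, X2 <= x, X3 <= x & X4 <= x].
  by rewrite !ge_max => /and3P[? /andP[? ?] /andP[? ?]].
have nd : forall x y, X <= x -> x <= y -> g x - c * ln x <= g y - c * ln y.
  apply: (@derive_nonneg_nondecreasing _ _ (fun x => g' x - c * x^-1)) => x.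
    move=> /XP[x1 x2 _ _ _]; have x0 : 0 < x by lra.
    have h := is_deriveB (dg _ x2) (is_deriveZ c (is_derive1_ln x0)).
    exact: is_derive_eq h _.
  move=> /XP[x1 _ _ x3 _]; have x0 : 0 < x by lra.
  by rewrite subr_ge0 ler_pdivrMr// mulrC cg'.
pose C := g X - c * ln X.
(* Monotonicity gives [C <= - (c - lambda) / 2 * ln y], and [ln y >= t] makes the right side at most
   [C - 1]. *)
pose t := Num.max 1 (2 * (1 - C) / (c - lambda)).
pose y := Num.max X (expR t).
have Xy : X <= y by rewrite le_max lexx.
have [y1 _ y2 _ y4] := XP _ Xy.
have ty : t <= ln y.
  by rewrite -[leLHS]expRK ler_ln ?posrE ?expR_gt0// ?le_max ?lexx ?orbT//; lra.
have t1 : 1 <= t by rewrite le_max lexx.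
have tC : 1 - C <= (c - lambda) / 2 * t.
  rewrite -ler_pdivrMl//; apply: (@le_trans _ _ (2 * (1 - C) / (c - lambda))).
    by rewrite invf_div mulrAC.
  by rewrite le_max lexx orbT.
have := rle _ y4; have := nd X y (lexx _) Xy; rewrite -/C gE// => h1.
have l0 : 0 < ln y by lra.
rewrite normrM normr_id normfV (gtr0_norm l0) ler_pdivrMr// => h2.
have h3 := ler_norm (r y).
have : (c - lambda) / 2 * t <= (c - lambda) / 2 * ln y by rewrite ler_pM2l.
nra.
Qed.

(** The sign of [x g'(x) - (lambda + eps)], and of its analogue with [lambda - eps], is eventually
    constant, and the growth of [g] excludes the wrong sign. Then [g - (lambda - eps) ln] is
    nondecreasing and [g - (lambda + eps) ln] is nonincreasing. *)
Lemma hardy_log_slope (R : realType) (alpha r1 : R -> R) (gamma lambda : R) :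
  sub_polynomial alpha ->
  (\forall x \near +oo, alpha x = gamma * x + lambda * ln x + r1 x) ->
  `|r1 x| / ln x @[x --> +oo] --> 0 ->
  log_slope (fun x => alpha x - gamma * x) lambda.
Proof.
move=> [[H HH Ha] _] aE r0 eps eps0.
pose g x := alpha x - gamma * x; pose g' x := derive1 alpha x - gamma.
have dg : \forall x \near +oo, is_derive (x : R) (1 : R) g (g' x).
  apply: filterS (hardy_is_derive HH Ha) => x dx.
  have h := is_deriveB dx (is_deriveZ gamma (is_derive_id x 1)).
  by apply: is_derive_eq h _; rewrite /GRing.scale/= mulr1.
have gE : \forall x \near +oo, g x = lambda * ln x + r1 x.
  by apply: filterS aE => x; rewrite /g => ->; ring.
have sgn e := hardy_mulX_eventually_signed HH gamma e (hardy_derive HH Ha).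
have up : \forall x \near +oo, x * g' x < lambda + eps.
  have [h|h|] := sgn (lambda + eps); last first.
  - by apply: filterS => x; rewrite subr_lt0.
  - exfalso; apply: (log_growth_derive_bound dg gE r0 (c := lambda + eps)).
      by rewrite ltrDl.
    by apply: filterS h => x; rewrite subr_gt0 => /ltW.
  - exfalso; apply: (log_growth_derive_bound dg gE r0 (c := lambda + eps)).
      by rewrite ltrDl.
    by apply: filterS h => x /eqP; rewrite subr_eq0 => /eqP ->.
have lo : \forall x \near +oo, lambda - eps < x * g' x.
  have nlo : ~ (\forall x \near +oo, x * g' x <= lambda - eps).
    move=> h; apply: (@log_growth_derive_bound _ (fun x => - g x)
      (fun x => - g' x) (fun x => - r1 x) (- lambda) (- (lambda - eps))).
    - by apply: filterS dg => x dx; apply: is_deriveN.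
    - by apply: filterS gE => x ->; ring.
    - by under eq_fun do rewrite normrN.
    - lra.
    - by apply: filterS h => x; rewrite mulrN lerN2.
  have [h|h|h] := sgn (lambda - eps).
  - exfalso; apply: nlo; apply: filterS h => x /eqP.
    by rewrite subr_eq0 => /eqP ->.
  - by apply: filterS h => x; rewrite subr_gt0.
  - by exfalso; apply: nlo; apply: filterS h => x; rewrite subr_lt0 => /ltW.
move: dg up lo => /near_pinftyP[X1 dg] /near_pinftyP[X2 up] /near_pinftyP[X3 lo].
pose X := Num.max 1 (Num.max X1 (Num.max X2 X3)).
have XP x : X <= x -> [/\ 1 <= x, X1 <= x, X2 <= x & X3 <= x].
  by rewrite !ge_max => /and4P[].
exists X; first by rewrite lt_max ltr01.
have dgc c x : X <= x -> is_derive x 1 (fun x => g x - c * ln x) (g' x - c * x^-1).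
  move=> /XP[x1 x2 _ _]; have x0 : 0 < x by lra.
  exact: is_deriveB (dg _ x2) (is_deriveZ c (is_derive1_ln x0)).
move=> x y Xx xy; rewrite ler_norml; apply/andP; split.
  have : g x - (lambda - eps) * ln x <= g y - (lambda - eps) * ln y.
    move: x y Xx xy; apply: (derive_nonneg_nondecreasing (dgc _)) => x.
    move=> /XP[x1 _ _ x3]; have x0 : 0 < x by lra.
    by rewrite subr_ge0 ler_pdivrMr// mulrC ltW// lo.
  by rewrite /g; lra.
have : - (g x - (lambda + eps) * ln x) <= - (g y - (lambda + eps) * ln y).
  move: x y Xx xy; apply: (derive_nonneg_nondecreasing
    (fun x Xx => is_deriveN (dgc (lambda + eps) x Xx))) => x.
  move=> /XP[x1 _ x2 _]; have x0 : 0 < x by lra.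
  by rewrite oppr_ge0 subr_le0 ler_pdivlMr// mulrC ltW// up.
by rewrite /g; lra.
Qed.

(** A logarithmic slope gives no monotonicity when [lambda = 0]; the eventual sign of
    [alpha' - gamma] does. *)
Lemma hardy_sub_linear_monotone (R : realType) (alpha : R -> R) (gamma : R) :
  sub_polynomial alpha ->
  (exists X : R, forall x y, X <= x -> x <= y ->
     alpha x - gamma * x <= alpha y - gamma * y) \/
  (exists X : R, forall x y, X <= x -> x <= y ->
     alpha y - gamma * y <= alpha x - gamma * x).
Proof.
move=> [[H HH Ha] _].
apply: (@eventually_monotone _ _ (fun x => derive1 alpha x + (- gamma) * 1)).
  apply: filterS (hardy_is_derive HH Ha) => x dx.
  have h := is_deriveB dx (is_deriveZ gamma (is_derive_id x 1)).
  by apply: is_derive_eq h _; rewrite /GRing.scale/= !mulr1.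
exact: (hardy_linear_eventually_signed HH (- gamma) (hardy_derive HH Ha)
  (hardy_one HH)).
Qed.

(** * Distance to the nearest integer *)

Lemma nearest_intP (R : realType) (t : R) (k : int) :
  reflect (nearest_int t = k) (k%:~R - 1 / 2 <= t < k%:~R + 1 / 2).
Proof.
apply: (iffP idP) => [/andP[h1 h2]|<-].
  by apply: floor_def; rewrite intrD; apply/andP; split; lra.
rewrite /nearest_int; have := floor_itv (t + 1 / 2); rewrite intrD.
by move=> /andP[h1 h2]; apply/andP; split; lra.
Qed.

Lemma nearest_int_itv (R : realType) (t : R) :
  (nearest_int t)%:~R - 1 / 2 <= t < (nearest_int t)%:~R + 1 / 2.
Proof. exact/nearest_intP. Qed.

Lemma dist_int_le_half (R : realType) (t : R) : dist_int t <= 1 / 2.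
Proof.
by have /andP[h1 h2] := nearest_int_itv t; rewrite /dist_int ler_norml; lra.
Qed.

Lemma dist_int_ge0 (R : realType) (t : R) : 0 <= dist_int t.
Proof. exact: normr_ge0. Qed.

Lemma dist_int_le (R : realType) (t : R) (k : int) : dist_int t <= `|t - k%:~R|.
Proof.
have [->|kN] := eqVneq k (nearest_int t); first by [].
apply: le_trans (dist_int_le_half t) _.
have /andP[h1 h2] := nearest_int_itv t.
have [h|h|h] := ltgtP k (nearest_int t); last by rewrite h eqxx in kN.
- have {}h : k + 1 <= nearest_int t by lia.
  move: h; rewrite -(ler_int R) intrD => h.
  by rewrite ger0_norm; lra.
- have {}h : nearest_int t + 1 <= k by lia.
  move: h; rewrite -(ler_int R) intrD => h.
  by rewrite ler0_norm; lra.
Qed.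

Lemma dist_intE (R : realType) (t : R) :
  exists2 k : int, dist_int t = `|t - k%:~R| & `|t - k%:~R| <= 1 / 2.
Proof. by exists (nearest_int t) => //; exact: dist_int_le_half. Qed.

Lemma dist_int_small (R : realType) (t : R) : `|t| <= 1 / 2 -> dist_int t = `|t|.
Proof.
move=> t2; apply/eqP; rewrite eq_le; apply/andP; split.
  by have := dist_int_le t 0; rewrite subr0.
have [k -> _] := dist_intE t; have [->|k0] := eqVneq k 0; first by rewrite subr0.
have : 1 <= `|k%:~R| :> R by rewrite -intr_norm ler1z; lia.
by have := lerB_dist k%:~R t; rewrite (distrC k%:~R); lra.
Qed.

Lemma dist_intN (R : realType) (t : R) : dist_int (- t) = dist_int t.
Proof.
have le (s : R) : dist_int (- s) <= dist_int s.
  have [k -> _] := dist_intE s; have := dist_int_le (- s) (- k).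
  by rewrite intrN -opprD normrN.
by apply/eqP; rewrite eq_le le/=; have := le (- t); rewrite opprK.
Qed.

Lemma dist_int_add (R : realType) (s t : R) :
  dist_int (s + t) <= dist_int s + dist_int t.
Proof.
have [k -> _] := dist_intE s; have [l -> _] := dist_intE t.
apply: le_trans (dist_int_le _ (k + l)) _; rewrite intrD opprD addrACA.
exact: ler_normD.
Qed.

Lemma dist_int_norm (R : realType) (t : R) : dist_int t <= `|t|.
Proof. by have := dist_int_le t 0; rewrite subr0. Qed.

Lemma dist_int_lipschitz (R : realType) (s t : R) :
  dist_int s <= dist_int t + `|s - t|.
Proof.
have := dist_int_add t (s - t); have := dist_int_norm (s - t).
by rewrite subrKC; lra.
Qed.

Lemma dist_int_intr (R : realType) (k : int) : dist_int (k%:~R : R) = 0.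
Proof.
apply/eqP; rewrite eq_le dist_int_ge0 andbT.
by have := dist_int_le (k%:~R : R) k; rewrite subrr normr0.
Qed.

Lemma dist_intDz (R : realType) (t : R) (k : int) :
  dist_int (t + k%:~R) = dist_int t.
Proof.
apply/eqP; rewrite eq_le; apply/andP; split.
  by have := dist_int_add t k%:~R; rewrite dist_int_intr addr0.
by have := dist_int_add (t + k%:~R) (- k%:~R); rewrite addrK dist_intN
  dist_int_intr addr0.
Qed.

Lemma dist_int_mulrn (R : realType) (n : nat) (t : R) :
  dist_int (n%:R * t) <= n%:R * dist_int t.
Proof.
have [k -> _] := dist_intE t; apply: le_trans (dist_int_le _ (n%:Z * k)) _.
by rewrite intrM -mulrBr normrM (ger0_norm (ler0n _ _)).
Qed.

Lemma dist_int_eq0 (R : realType) (t : R) :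
  dist_int t = 0 -> exists k : int, t = k%:~R.
Proof.
have [k -> _] := dist_intE t => /eqP; rewrite normr_eq0 subr_eq0 => /eqP ->.
by exists k.
Qed.

(* [s] and [s - d] both lie in the closed arc of length [l] centred at [1/2],
   so that [d] is at most [l]; equality forces them to be its two ends. *)
Lemma dist_int_extremal (R : realType) (s d l eta : R) :
  1 / 2 - l / 2 - eta <= dist_int s -> 1 / 2 - l / 2 - eta <= dist_int (s - d) ->
  l <= dist_int d -> dist_int (2 * s - d) <= 2 * eta.
Proof.
have centred (t : R) : exists k : int, `|t - k%:~R - 1 / 2| = 1 / 2 - dist_int t.
  have [k -> k2] := dist_intE t; have [h|h] := leP 0 (t - k%:~R).
    by exists k; move: k2; rewrite (ger0_norm h) => k2; rewrite ler0_norm; lra.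
  exists (k - 1); rewrite intrB; move: k2; rewrite (ltr0_norm h) => k2.
  by rewrite ger0_norm; lra.
move=> h1 h2 dl; have [k ke] := centred s; have [m me] := centred (s - d).
set a := s - _ - _ in ke; set b := s - d - _ - _ in me.
have {}h1 : `|a| <= l / 2 + eta by lra.
have {}h2 : `|b| <= l / 2 + eta by lra.
have {}dl : l <= `|a - b|.
  apply: le_trans dl _; have := dist_int_le d (k - m).
  congr (_ <= `|_|); rewrite /a /b intrB; lra.
have : `|a + b| <= 2 * eta.
  move: h1 h2 dl; rewrite !ler_norml.
  by case: (leP 0 (a - b)) => ab; rewrite ?(ger0_norm ab) ?(ltr0_norm ab); lra.
apply: le_trans; have := dist_int_le (2 * s - d) (k + m + 1).
by congr (_ <= `|_|); rewrite /a /b !intrD; lra.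
Qed.

(** With [e] the representative of [d] modulo [1] of least absolute value, [s] and [s - d] are
    placed symmetrically, at [1/2 + e/2] and [1/2 - e/2] modulo [1]. *)
Lemma dist_int_separated (R : realType) (d l : R) : dist_int d < l ->
  exists s : R, 1 / 2 - l / 2 < dist_int s /\ 1 / 2 - l / 2 < dist_int (s - d).
Proof.
have [k -> k2] := dist_intE d; set e := d - k%:~R in k2 * => el.
have half (t : R) : `|t| <= 1 / 4 -> dist_int (1 / 2 + t) = 1 / 2 - `|t|.
  move=> t4; have [t0|t0] := leP 0 t.
    move: t4; rewrite ger0_norm// => t4.
    rewrite -(dist_intDz _ (-1)) dist_int_small; last first.
      by rewrite intrN ler_norml; lra.
    by rewrite intrN ler0_norm; lra.
  move: t4; rewrite ltr0_norm// => t4.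
  by rewrite dist_int_small ger0_norm; lra.
have e2 : `|e / 2| = `|e| / 2 by rewrite normrM (@ger0_norm _ 2^-1).
exists (1 / 2 + e / 2); rewrite half; last by rewrite e2; lra.
split; first by rewrite e2; lra.
have -> : 1 / 2 + e / 2 - d = 1 / 2 + - (e / 2) + (- k)%:~R.
  by rewrite /e intrN; field.
by rewrite dist_intDz half ?normrN e2; lra.
Qed.

(** * Approximation on the circle *)

(** The circle is cut into [K] arcs of length [1 / K < eps]. The finite colouring stands in for
    compactness, here and in the choice of bounded representatives. *)
Lemma circle_cells (R : realType) (eps : R) : 0 < eps ->
  exists (K : nat) (cell : R -> 'I_K),
    forall s t, cell s = cell t -> dist_int (s - t) < eps.
Proof.
move=> eps0.
have [K K0 Ke] : exists2 K : nat, 0 < K%:R :> R & 1 < eps * K%:R.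
  exists (Num.truncn eps^-1).+1; first by rewrite ltr0n.
  by rewrite -ltr_pdivrMl// mulr1; exact: truncnS_gt.
pose fr (t : R) := t - (Num.floor t)%:~R.
have fr0 t : 0 <= fr t by rewrite subr_ge0 floor_le.
have fr1 t : fr t < 1.
  by have /andP[_] := floor_itv t; rewrite intrD /fr => h; lra.
have tr t : (Num.truncn (K%:R * fr t) < K)%N.
  rewrite -(ltr_nat R); apply: le_lt_trans (_ : K%:R * fr t < _).
    by rewrite truncn_le mulr_ge0// ltW.
  by rewrite gtr_pMr.
exists K, (fun t => Ordinal (tr t)) => s t [] e.
have bnd z :
    (Num.truncn (K%:R * fr z))%:R <= K%:R * fr z < (Num.truncn (K%:R * fr z)).+1%:R.
  by apply: truncn_itv; rewrite mulr_ge0// ltW.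
have /andP[s1 s2] := bnd s; have /andP[t1 t2] := bnd t.
apply: le_lt_trans (dist_int_le _ (Num.floor s - Num.floor t)) _.
have -> : s - t - (Num.floor s - Num.floor t)%:~R = fr s - fr t.
  by rewrite /fr intrB; ring.
have : K%:R * `|fr s - fr t| < K%:R * eps.
  rewrite -[X in X * _](ger0_norm (ltW K0)) -normrM mulrBr.
  apply: le_lt_trans (_ : 1 < _); last by rewrite mulrC.
  by move: s1 s2 t2; rewrite -!natr1 e => s1 s2 t2; rewrite ler_norml; lra.
by rewrite ltr_pM2l.
Qed.

Lemma dirichlet_approx (R : realType) (theta eps : R) : 0 < eps ->
  exists2 q : nat, (0 < q)%N & dist_int (q%:R * theta) < eps.
Proof.
move=> /circle_cells[K [cell cellP]].
pose f (i : 'I_K.+1) := cell (i%:R * theta).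
have /injectivePn[i [j ij fij]] : ~~ injectiveb f.
  by apply/negP => /injectiveP/leq_card; rewrite !card_ord ltnn.
wlog lt_ij : i j ij fij / (i < j)%N.
  move=> W; have := ij; rewrite neq_ltn => /orP[/W|/W]; first exact.
  by apply; rewrite // eq_sym.
exists (j - i)%N; first by rewrite subn_gt0.
by rewrite natrB 1?ltnW// mulrBl; exact/cellP/esym.
Qed.

(** The only obstruction is a finite orbit of [theta] that stays away from [u]; the hypothesis
    excludes it, either because [0] lies in every orbit or because [theta] is irrational. *)
Lemma bohr_syndetic (R : realType) (theta u eps : R) : 0 < eps ->
  u = 0 \/ (forall q : nat, (0 < q)%N -> dist_int (q%:R * theta) != 0) ->
  exists2 L : nat, (0 < L)%N & forall M : nat, exists2 x : nat,
    (M <= x < M + L)%N & dist_int (x%:R * theta - u) < eps.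
Proof.
move=> eps0 hu; have [q q0] := dirichlet_approx theta eps0.
have [k ek _] := dist_intE (q%:R * theta); rewrite ek => qe.
set sg := q%:R * theta - k%:~R in ek qe.
have [sg0|sgN0] := eqVneq sg 0.
  have [u0|/(_ _ q0)] := hu; last by rewrite ek sg0 normr0 eqxx.
  (* The first multiple of [q] beyond [M] may equal [M + q], hence the length [q.+1]. *)
  exists q.+1 => // M; exists ((M %/ q).+1 * q)%N.
    have := ltn_pmod M q0; have := divn_eq M q; rewrite mulSn.
    by move: (_ %/ _ * _)%N (_ %% _)%N => a b; lia.
  rewrite u0 subr0 natrM -mulrA; apply: le_lt_trans (dist_int_mulrn _ _) _.
  by rewrite ek sg0 normr0 mulr0.
have a0 : 0 < `|sg| by rewrite normr_gt0.
pose J := (Num.truncn `|sg|^-1).+1.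
exists (J * q)%N => [|M]; first by rewrite muln_gt0.
(* The orbit moves by less than [eps] at each of the steps [q], hence within
   one turn it comes within [eps] of the target. *)
have step (w : R) : exists2 j : nat, (j < J)%N & dist_int (w + j%:R * `|sg|) < eps.
  pose t := (Num.ceil w)%:~R - w.
  have /andP[c1 c2] : (Num.ceil w - 1)%:~R < w <= (Num.ceil w)%:~R.
    exact: ceil_itv.
  rewrite intrB in c1; have t0 : 0 <= t by rewrite /t; lra.
  have t1 : t < 1 by rewrite /t; lra.
  have v0 : 0 <= t / `|sg| by rewrite divr_ge0 // ltW.
  have /andP[j1 j2] := truncn_itv v0.
  exists (Num.truncn (t / `|sg|)).
    rewrite ltnS; apply: le_truncn.
    by rewrite ler_pdivrMr// mulVf ?gt_eqF// ltW.
  move: j1 j2; rewrite ler_pdivlMr// ltr_pdivrMr// -natr1 => j1 j2.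
  apply: le_lt_trans (dist_int_le _ (Num.ceil w)) _.
  rewrite ler0_norm; first by rewrite /t in j1 j2; lra.
  by rewrite /t in j1 j2; lra.
have lin (j : nat) : (M + j * q)%:R * theta - u =
    M%:R * theta - u + j%:R * sg + (j%:Z * k)%:~R.
  by rewrite natrD natrM intrM /sg -[j%:~R]/(j%:R); ring.
have [sgp|sgn] := leP 0 sg.
  have [j jJ] := step (M%:R * theta - u); rewrite ger0_norm// => je.
  exists (M + j * q)%N; first by rewrite leq_addr ltn_add2l ltn_pmul2r.
  by rewrite lin dist_intDz.
have [j jJ] := step (- (M%:R * theta - u)); rewrite ltr0_norm// => je.
exists (M + j * q)%N; first by rewrite leq_addr ltn_add2l ltn_pmul2r.
rewrite lin dist_intDz -dist_intN; apply: le_lt_trans je.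
by rewrite le_eqVlt; apply/orP; left; apply/eqP; congr dist_int; ring.
Qed.

(** * Upper density *)

Definition count_upto (A : set nat) (N : nat) : nat :=
  count (fun k => `[< A k >]) (iota 1 N).

Lemma card_fset_set_count_upto (A : set nat) (N : nat) :
  #|` fset_set (A `&` [set k | (1 <= k <= N)%N])| = count_upto A N.
Proof.
pose F := [fset k in [seq k <- iota 1 N | `[< A k >]]]%fset.
have -> : A `&` [set k | (1 <= k <= N)%N] = [set` F].
  rewrite eqEsubset; split=> k /=.
    move=> [Ak /andP[k1 kN]]; rewrite !inE mem_filter mem_iota.
    by apply/andP; split; [exact/asboolP|lia].
  rewrite !inE mem_filter mem_iota => /andP[/asboolP Ak kN].
  by split=> //; lia.
by rewrite set_fsetK card_fseq undup_id ?filter_uniq ?iota_uniq// size_filter.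
Qed.

(** All later density estimates go through this form, which involves neither a limit superior nor a
    quotient, only counts on lists. *)
Lemma upper_density_gt0 (R : realType) (A : set nat) :
  (0 < upper_density R A)%E <->
  exists2 d : R, 0 < d & forall N0 : nat, exists2 N : nat, (N0 < N)%N &
    d * N%:R <= (count_upto A N)%:R.
Proof.
pose f N : \bar R := ((count_upto A N)%:R / N%:R)%:E.
have -> : upper_density R A = limn_esup f.
  by congr limn_esup; apply/funext => N; rewrite card_fset_set_count_upto.
rewrite /limn_esup limf_esupE; split=> [pos|[d d0 dN]].
  have [d d0 dinf] : exists2 d : R, 0 < d &
      (d%:E < ereal_inf [set ereal_sup (f @` V) | V in \oo])%E.
    case: (ereal_inf _) pos => [r| |]//; last by exists 1 => //; exact: ltry.
    by rewrite lte_fin => r0; exists (r / 2); rewrite ?lte_fin; lra.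
  exists d => // N0; pose V := [set N | (N0 < N)%N].
  have : (d%:E < ereal_sup (f @` V))%E.
    apply: lt_le_trans dinf _; apply: ereal_inf_lbound; exists V => //.
    exact: nbhs_infty_gt.
  move=> /ereal_sup_gt[_ [N /= N0N <-]]; rewrite lte_fin => dfN; exists N => //.
  move: dfN; rewrite ltr_pdivlMr; first exact: ltW.
  by rewrite ltr0n; exact: leq_ltn_trans N0N.
apply: (@lt_le_trans _ _ d%:E); first by rewrite lte_fin.
apply: le_ereal_inf_tmp => _ [V [N0 _ N0V] <-].
have [N N0N dle] := dN N0; apply: (@le_trans _ _ (f N)).
  by rewrite lee_fin ler_pdivlMr// ltr0n; lia.
by apply: ereal_sup_ubound; exists N => //; apply: N0V; exact: ltnW.
Qed.

Lemma count_iota_interval (p : pred nat) (M n x0 w : nat) :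
  (forall x, (M <= x < M + n)%N -> p x -> (x0 <= x < x0 + w)%N) ->
  (count p (iota M n) <= w)%N.
Proof.
move=> h; rewrite -size_filter -[leqRHS](size_iota x0).
apply: uniq_leq_size; first by rewrite filter_uniq// iota_uniq.
by move=> x; rewrite mem_filter !mem_iota => /andP[px xM]; exact: h.
Qed.

Lemma count_iota_cat (p : pred nat) (a b c : nat) : (a <= b <= c)%N ->
  count p (iota a (c - a)) =
  (count p (iota a (b - a)) + count p (iota b (c - b)))%N.
Proof.
move=> /andP[ab bc]; have -> : (c - a = (b - a) + (c - b))%N by lia.
by rewrite iotaD count_cat subnKC.
Qed.

Lemma count_iota_blocks (p : pred nat) (M L k : nat) :
  (forall a, (M <= a)%N -> (a + L <= M + k * L)%N ->
     exists2 x, (a <= x < a + L)%N & p x) ->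
  (k <= count p (iota M (k * L)))%N.
Proof.
elim: k => // k IHk h; rewrite mulSn addnC iotaD count_cat -addn1.
apply: leq_add.
  by apply: IHk => a Ma aL; apply: h => //; rewrite mulSn; lia.
rewrite -has_count; apply/hasP.
have [||x xM px] := h (M + k * L)%N; [lia|by rewrite mulSn; lia|].
by exists x => //; rewrite mem_iota.
Qed.

(** If each difference stopped occurring at some point, then far out all gaps of [A] would exceed a
    given [H], and the density would be at most [1 / H]. *)
Lemma upper_density_gt0_common_difference (R : realType) (A : set nat) :
  (0 < upper_density R A)%E ->
  exists2 h : nat, (0 < h)%N &
    forall X : nat, exists2 x : nat, (X <= x)%N & A x /\ A (x + h)%N.
Proof.
move=> /upper_density_gt0[d d0 dN]; apply: contrapT => noh.
have sep h : (0 < h)%N -> exists X : nat, forall x, (X <= x)%N -> A x ->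
    ~ A (x + h)%N.
  move=> h0; apply: contrapT => noX; apply: noh; exists h => // X.
  apply: contrapT => nox; apply: noX; exists X => x Xx Ax Axh.
  by apply: nox; exists x.
have sepH H : exists X : nat, forall h x, (0 < h <= H)%N -> (X <= x)%N -> A x ->
    ~ A (x + h)%N.
  elim: H => [|H [X HX]]; first by exists 0%N => h x; lia.
  have [Y HY] := sep H.+1 isT; exists (maxn X Y) => h x hH.
  rewrite geq_max => /andP[Xx Yx]; have [->|hN] := eqVneq h H.+1; first exact: HY.
  by apply: HX => //; lia.
pose H := (Num.truncn (2 / d)).+1.
have Hd : 2 < d * H%:R by rewrite -ltr_pdivrMl// mulrC; exact: truncnS_gt.
have H0 : (0 < H)%N by [].
move: H Hd H0 => H Hd H0.
have [X HX] := sepH H.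
have bound N : (count_upto A N <= X + (N %/ H).+1)%N.
  have [NX|XN] := leqP N X.
    apply: leq_trans (count_size _ _) _; rewrite size_iota.
    exact: leq_trans NX (leq_addr _ _).
  rewrite /count_upto -[X in iota 1 X](_ : N.+1 - 1 = N)%N; last by lia.
  rewrite (@count_iota_cat _ 1 X.+1); last by lia.
  apply: leq_add.
    by apply: leq_trans (count_size _ _) _; rewrite size_iota; lia.
  (* Beyond [X] each block of length [H] holds at most one element of [A], so [x %/ H] determines
     [x]. *)
  rewrite -size_filter -(size_map (divn^~ H)) -[leqRHS](size_iota 0).
  apply: uniq_leq_size.
    rewrite map_inj_in_uniq ?filter_uniq ?iota_uniq// => x y.
    rewrite !mem_filter !mem_iota => /andP[/asboolP Ax xX] /andP[/asboolP Ay yX].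
    wlog xy : x y Ax xX Ay yX / (x < y)%N.
      move=> W e; have [xy|xy|//] := ltngtP x y; first exact: W e.
      by apply/esym; apply: W.
    move=> e; exfalso; apply: (HX (y - x)%N x); rewrite ?subnKC//; last 2 first.
    - lia.
    - exact: ltnW.
    have := divn_eq x H; have := divn_eq y H; rewrite e.
    by have := ltn_pmod y H0; have := ltn_pmod x H0; lia.
  move=> _ /mapP[x + ->]; rewrite mem_filter !mem_iota => /andP[_ xX].
  by rewrite add0n ltnS leq_div2r//; lia.
have [N NX] := dN (2 * (X + 1) * H)%N; apply/negP; rewrite -ltNge.
apply: (@le_lt_trans _ _ (X + (N %/ H).+1)%:R); first by rewrite ler_nat.
have : ((N %/ H) * H <= N)%N by exact: leq_trunc_div.
rewrite -(ler_nat R) natrM => h1; move: NX; rewrite -(ltr_nat R) !natrM => h2.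
have H0' : 0 < H%:R :> R by rewrite ltr0n.
rewrite natrD -natr1 -(ltr_pM2r H0'); rewrite natrD in h2.
have N0 : 0 < N%:R :> R.
  apply: le_lt_trans h2; have : 0 <= X%:R :> R by [].
  by nra.
have : 2 * N%:R < d * H%:R * N%:R by rewrite ltr_pM2r.
nra.
Qed.

Lemma ltn_subS_le (b x N : nat) :
  (b <= x < b + (N.+1 - b))%N -> (b <= x <= N)%N.
Proof. by lia. Qed.

(** Far out, the elements of [A] in a window [(N / rho2, N]] all lie within a factor [rho1] of the
    least of them, so they fill only a small proportion of the window. Summing over the windows of
    ratio [rho2] below [N] bounds the density, and [rho1] is as close to [1] as desired. *)
Lemma upper_density_le0_of_log_gaps (R : realType) (A : set nat) (rho2 : R) :
  1 < rho2 ->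
  (forall rho1 : R, 1 < rho1 -> exists X : nat, forall x y : nat,
     (X <= x)%N -> A x -> A y -> rho1 * x%:R <= y%:R -> y%:R <= rho2 * x%:R ->
     False) ->
  ~ (0 < upper_density R A)%E.
Proof.
move=> rho2_gt1 gap /upper_density_gt0[d d0 dN].
(* With this value the bound [2 * t * N] for one window equals [d / 2 * (N - N / rho2)], so the
   bounds telescope to [d / 2 * N]. *)
pose t := d * (rho2 - 1) / (4 * rho2).
have t0 : 0 < t by rewrite divr_gt0 ?mulr_gt0//; lra.
have [X0 HX0] := gap (1 + t) ltac:(lra).
pose X := (X0 + (Num.truncn t^-1).+1)%N.
have Xt : 1 <= t * X%:R.
  rewrite -ler_pdivrMl// mulr1 natrD ltW//.
  by rewrite (lt_le_trans (truncnS_gt _))// lerDr.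
have X1 : (0 < X)%N by rewrite /X addnS.
have XX0 : (X0 <= X)%N by rewrite leq_addr.
move: X Xt X1 XX0 => X Xt X1 XX0.
pose p k := `[< A k >].
pose a N := count p (iota X (N.+1 - X)).
have ale N : (a N)%:R <= d / 2 * N%:R :> R.
  have [n] := ubnP N; elim: n N => // n IHn N; rewrite ltnS => Nn.
  have [NX|XN] := ltnP N X.
    have -> : a N = 0%N by rewrite /a (_ : N.+1 - X = 0)%N//; lia.
    by rewrite mulr_ge0//; lra.
  have N0 : 0 < N%:R :> R by rewrite ltr0n; lia.
  have v0 : 0 <= N%:R / rho2 by rewrite divr_ge0//; lra.
  have /andP[M1 M2] := truncn_itv v0; set M := Num.truncn _ in M1 M2.
  have MN : (M < N)%N.
    rewrite -(ltr_nat R); apply: le_lt_trans M1 _.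
    by rewrite ltr_pdivrMr; [rewrite ltr_pMr|lra].
  pose b := maxn X M.+1.
  have tail : (count p (iota b (N.+1 - b)))%:R <= 2 * t * N%:R :> R.
    have [[x0 [/andP[bx0 x0N] px0 minx0]]|none] := pselect (exists x0,
        [/\ (b <= x0 <= N)%N, p x0 & forall x, (b <= x <= N)%N -> p x -> (x0 <= x)%N]).
      have wtn := truncn_itv (mulr_ge0 (ltW t0) (ltW N0)).
      apply: (@le_trans _ _ (Num.truncn (t * N%:R)).+1%:R).
        rewrite ler_nat; apply: (@count_iota_interval _ _ _ x0) => x xb px.
        have xbN := ltn_subS_le xb.
        rewrite minx0//= -(ltr_nat R) natrD -ltrBlDl.
        apply: le_lt_trans (truncnS_gt (t * N%:R)).
        rewrite leNgt; apply/negP => far.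
        have Xx0 : (X <= x0)%N by apply: leq_trans bx0; rewrite leq_maxl.
        apply: (HX0 x0 x); [exact: leq_trans Xx0|exact/asboolP|exact/asboolP| |].
          rewrite mulrDl mul1r.
          have : t * x0%:R <= t * N%:R by rewrite ler_pM2l// ler_nat.
          lra.
        have xN : x%:R <= N%:R :> R by rewrite ler_nat; case/andP: xbN.
        apply: le_trans xN _; rewrite mulrC -ler_pdivrMr; last by lra.
        apply: le_trans (ltW M2) _; rewrite ler_nat.
        by apply: leq_trans bx0; rewrite leq_maxr.
      have : t * X%:R <= t * N%:R by rewrite ler_pM2l// ler_nat.
      by case/andP: wtn => w1 w2; rewrite -natr1; lra.
    rewrite (_ : count _ _ = 0%N); first by rewrite mulr_ge0// mulr_ge0//; lra.
    apply/eqP; rewrite -leqn0 leqNgt -has_count; apply/negP => /hasP[x].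
    rewrite mem_iota => xb px; apply: none.
    pose P x := (b <= x <= N)%N && p x.
    have exP : exists x, P x by exists x; rewrite /P px andbT (ltn_subS_le xb).
    case: (ex_minnP exP) => m /andP[mb pm] mmin; exists m; split=> // y yb py.
    by apply: mmin; rewrite /P yb.
  have -> : a N = (count p (iota X (b - X)) + count p (iota b (N.+1 - b)))%N.
    by apply: count_iota_cat; rewrite /b; lia.
  rewrite natrD; have -> : count p (iota X (b - X)) = a M.
    by rewrite /a /b; congr (count _ (iota _ _)); lia.
  have aM : (a M)%:R <= d / 2 * M%:R :> R by apply: IHn; lia.
  have dM : d / 2 * M%:R <= d / 2 * (N%:R / rho2) by rewrite ler_pM2l//; lra.
  have te : 2 * t * N%:R = d / 2 * (N%:R - N%:R / rho2).
    by rewrite /t; field; lra.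
  lra.
have [N NX] := dN (2 * X * (Num.truncn d^-1).+1)%N.
apply/negP; rewrite -ltNge.
have dt : 1 < d * (Num.truncn d^-1).+1%:R.
  by rewrite -ltr_pdivrMl// mulr1; exact: truncnS_gt.
have : (count_upto A N <= (X - 1) + a N)%N.
  have [NX'|XN] := ltnP N X.
    apply: leq_trans (count_size _ _) _; rewrite size_iota; lia.
  rewrite /count_upto -[X in iota 1 X](_ : N.+1 - 1 = N)%N; last by lia.
  rewrite (@count_iota_cat _ 1 X); last by lia.
  rewrite leq_add2r; apply: leq_trans (count_size _ _) _.
  by rewrite size_iota.
rewrite -(ler_nat R) natrD natrB// => h1.
have h2 := ale N; move: NX; rewrite -(ltr_nat R) !natrM => h3.
have : X%:R < d / 2 * N%:R :> R.
  have Xp : 0 < X%:R :> R by rewrite ltr0n.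
  move: h3 dt; move: (Num.truncn d^-1).+1%:R => w h3 dt.
  have : d / 2 * (2 * X%:R * w) < d / 2 * N%:R by rewrite ltr_pM2l//; lra.
  apply: lt_trans; have : X%:R * 1 < X%:R * (d * w) by rewrite ltr_pM2l.
  by rewrite (_ : d / 2 * (2 * X%:R * w) = X%:R * (d * w)); [lra|field].
lra.
Qed.

(** * Functions of logarithmic slope *)

Lemma ln_dist_le (R : realType) (s t : R) : 0 < s -> `|t - s| <= s / 2 ->
  `|ln t - ln s| <= 2 * `|t - s| / s.
Proof.
have up (u v : R) : 0 < u -> 0 < v -> ln v - ln u <= (v - u) / u.
  move=> u0 v0; rewrite -ln_div ?posrE//.
  have -> : v / u = 1 + (v - u) / u by field; lra.
  apply: le_ln1Dx; have -> : (v - u) / u = v / u - 1 by field; lra.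
  by have := divr_gt0 v0 u0; lra.
move=> s0 ts; have t0 : s / 2 <= t by move: ts; rewrite ler_norml; lra.
have h1 := up s t s0 ltac:(lra); have h2 := up t s ltac:(lra) s0.
have b1 : (t - s) / s <= 2 * `|t - s| / s.
  rewrite ler_pM2r ?invr_gt0//; have := ler_norm (t - s).
  by have := normr_ge0 (t - s); lra.
have b2 : (s - t) / t <= 2 * `|t - s| / s.
  have h := ler_norm (s - t); rewrite distrC in h.
  rewrite ler_pdivrMr; last by lra.
  rewrite mulrAC ler_pdivlMr//.
  have : `|t - s| * s <= `|t - s| * (2 * t) by rewrite ler_wpM2l//; lra.
  have : (s - t) * s <= `|t - s| * s by rewrite ler_pM2r.
  lra.
by rewrite ler_norml; lra.
Qed.

Lemma ler_max2 (R : realType) (a b c : R) :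
  Num.max a b <= c -> a <= c /\ b <= c.
Proof. by rewrite ge_max => /andP. Qed.

(** This is [g (c x) = g x + lambda ln c + o(1)], with a relative error allowed in [c x]. It is used
    with [c] equal to [1], [2] and [gamma^-1]. *)
Lemma log_slope_ratio (R : realType) (g : R -> R) (lambda c eps : R) :
  log_slope g lambda -> 0 < c -> 0 < eps ->
  exists2 zeta : R, 0 < zeta & exists2 X : R, 0 < X & forall x y : R, X <= x ->
    `|y - c * x| <= zeta * x -> `|g y - g x - lambda * ln c| <= eps.
Proof.
move=> slope c0 eps0; pose B := `|ln c| + 1.
have B1 : 1 <= B by rewrite lerDr.
have e0 : 0 < eps / (2 * B) by rewrite divr_gt0//; lra.
have [X X0 HX] := slope _ e0.
have HX2 x y : X <= x -> X <= y -> `|g y - g x - lambda * (ln y - ln x)| <=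
    eps / (2 * B) * `|ln y - ln x|.
  move=> Xx Xy; have [xy|yx] := leP x y.
    rewrite [in leRHS]ger0_norm ?HX// subr_ge0 ler_ln// posrE; lra.
  rewrite -normrN [in leRHS]distrC [in leRHS]ger0_norm; last first.
    by rewrite subr_ge0 ler_ln ?posrE; lra.
  by apply: le_trans (HX _ _ Xy (ltW yx)); rewrite le_eqVlt; apply/orP; left;
    apply/eqP; congr `|_|; ring.
(* The error in [ln y - ln x - ln c] is at most [2 * z]: its product with [lambda] costs at most
   [eps / 2], and since [2 * z <= 1] the constant [B] bounds [ln y - ln x] in absolute value. *)
pose z := Num.min (1 / 2) (eps / (4 * (`|lambda| + 1))).
have l1 : 0 < `|lambda| + 1 by rewrite ltr_wpDl.
have z0 : 0 < z by rewrite lt_min divr_gt0 ?divr_gt0//; lra.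
have z2 : z <= 1 / 2 by rewrite ge_min lexx.
have zl : 2 * `|lambda| * z <= eps / 2.
  have : (`|lambda| + 1) * z <= (`|lambda| + 1) * (eps / (4 * (`|lambda| + 1))).
    by rewrite ler_pM2l// ge_min lexx orbT.
  have -> : (`|lambda| + 1) * (eps / (4 * (`|lambda| + 1))) = eps / 4 by field; lra.
  lra.
exists (c * z); first by rewrite mulr_gt0.
exists (Num.max X (2 * X / c)); first by rewrite lt_max X0.
move=> x y /ler_max2[Xx]; rewrite ler_pdivrMr// => Xcx yx.
have x0 : 0 < x by lra.
have cx0 : 0 < c * x by rewrite mulr_gt0.
have yx' : `|y - c * x| <= z * (c * x) by rewrite mulrA [z * c]mulrC.
have yx2 : `|y - c * x| <= c * x / 2.
  by apply: le_trans yx' _; have : z * (c * x) <= 1 / 2 * (c * x);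
    [rewrite ler_pM2r|lra].
have Xy : X <= y by move: yx2; rewrite ler_norml; lra.
have := ln_dist_le cx0 yx2; rewrite lnM ?posrE// => lle.
have {}lle : `|ln y - ln x - ln c| <= 2 * z.
  have -> : ln y - ln x - ln c = ln y - (ln c + ln x) by ring.
  apply: le_trans lle _; rewrite ler_pdivrMr//; lra.
have lB : `|ln y - ln x| <= B.
  have -> : ln y - ln x = (ln y - ln x - ln c) + ln c by ring.
  by apply: le_trans (ler_normD _ _) _; rewrite /B; lra.
have h := HX2 _ _ Xx Xy.
have {}h : `|g y - g x - lambda * (ln y - ln x)| <= eps / 2.
  apply: le_trans h _; apply: (@le_trans _ _ (eps / (2 * B) * B)).
    by rewrite ler_pM2l.
  by have -> : eps / (2 * B) * B = eps / 2 by field; lra.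
have -> : g y - g x - lambda * ln c =
  (g y - g x - lambda * (ln y - ln x)) + lambda * (ln y - ln x - ln c) by ring.
apply: le_trans (ler_normD _ _) _; rewrite normrM.
have : `|lambda| * `|ln y - ln x - ln c| <= `|lambda| * (2 * z).
  by rewrite ler_wpM2l.
lra.
Qed.

Lemma log_slope_small_step (R : realType) (g : R -> R) (lambda H eps : R) :
  log_slope g lambda -> 0 < eps ->
  exists2 X : R, 0 < X & forall x y : R, X <= x -> `|y - x| <= H ->
    `|g y - g x| <= eps.
Proof.
move=> slope eps0; have [z z0 [X X0 HX]] := log_slope_ratio slope ltr01 eps0.
exists (Num.max X (H / z)); first by rewrite lt_max X0.
move=> x y /ler_max2[Xx]; rewrite ler_pdivrMr// mulrC => Hx yx.
have := HX x y Xx; rewrite ln1 mulr0 subr0 mul1r; apply.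
exact: le_trans yx Hx.
Qed.

Lemma log_slope_sublinear (R : realType) (g : R -> R) (lambda eps : R) :
  log_slope g lambda -> 0 < eps ->
  exists2 X : R, 0 < X & forall x : R, X <= x -> `|g x| <= eps * x.
Proof.
move=> slope eps0; have [X X0 HX] := slope _ ltr01.
pose l := `|lambda| + 1; have l0 : 0 < l by rewrite ltr_wpDl.
(* From [ln x <= d * x - ln d] the logarithm costs [l * d * x = eps / 2 * x]; the other half of
   [eps * x] absorbs the constant [C]. *)
pose d := eps / (2 * l); have d0 : 0 < d by rewrite divr_gt0// mulr_gt0.
pose C := `|g X| + l * `|ln X| + l * `|ln d|.
exists (Num.max X (2 * C / eps)); first by rewrite lt_max X0.
move=> x /ler_max2[Xx]; rewrite ler_pdivrMr// => Cx.
have x0 : 0 < x by lra.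
have h := HX _ _ (lexx _) Xx; rewrite mul1r in h.
have lx0 : 0 <= ln x - ln X by rewrite subr_ge0 ler_ln ?posrE.
have gx : `|g x| <= `|g X| + l * (ln x - ln X).
  have -> : g x = g X + (g x - g X - lambda * (ln x - ln X)) +
    lambda * (ln x - ln X) by ring.
  apply: le_trans (ler_normD _ _) _.
  have := ler_normD (g X) (g x - g X - lambda * (ln x - ln X)).
  by rewrite normrM (ger0_norm lx0) /l; lra.
have lnx : ln x <= d * x - ln d.
  have : ln (d * x) < d * x by apply: ln_sublinear; rewrite mulr_gt0.
  by rewrite lnM ?posrE//; lra.
have hX := ler_norm (- ln X); rewrite normrN in hX.
have hd := ler_norm (- ln d); rewrite normrN in hd.
have : l * (ln x - ln X) <= l * (d * x + `|ln d| + `|ln X|).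
  by rewrite ler_pM2l//; lra.
have ld : l * (d * x) = eps / 2 * x by rewrite /d; field; lra.
rewrite !mulrDr ld /C in Cx *; lra.
Qed.

(** * Phases of the attained integers *)

Definition attained (R : realType) (gamma : R) (g : R -> R) (m : nat) : Prop :=
  exists2 n : nat, posnat n & nearest_int (gamma * n%:R + g n%:R) = m%:Z.

(* The approximate solution [n] of [gamma n + g n = m]. *)
Definition phase (R : realType) (gamma lambda : R) (g : R -> R) (m : nat) : R :=
  (m%:R - g m%:R + lambda * ln gamma) / gamma.

Lemma bounded_prefix (R : realType) (f : nat -> R) (N : nat) :
  exists C : nat, forall n, (n < N)%N -> f n <= C%:R.
Proof.
elim: N => [|N [C HC]]; first by exists 0%N.
exists (C + (Num.truncn (f N)).+1)%N => n.
rewrite ltnS leq_eqVlt => /orP[/eqP ->|/HC h].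
  by apply: le_trans (ltW (truncnS_gt _)) _; rewrite ler_nat leq_addl.
by apply: le_trans h _; rewrite ler_nat leq_addr.
Qed.

Lemma natr_eventually_ge (R : realType) (X : R) :
  exists N : nat, forall n : nat, (N <= n)%N -> X <= n%:R.
Proof.
exists (Num.truncn X).+1 => n h.
by apply: le_trans (ltW (truncnS_gt X)) _; rewrite ler_nat.
Qed.

(** The index [n] of an attained [m] is close to [m / gamma], so [g n] is close to
    [g m - lambda ln gamma]. This is the origin of the term [lambda * ln gamma] in [phase]. *)
Lemma log_slope_near_index (R : realType) (g : R -> R) (lambda gamma eps : R) :
  log_slope g lambda -> 0 < gamma -> 0 < eps ->
  exists2 zeta : R, 0 < zeta & exists M : nat, forall m n : nat, (M <= m)%N ->
    `|gamma * n%:R - m%:R| <= zeta * m%:R ->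
    `|g n%:R - g m%:R + lambda * ln gamma| <= eps.
Proof.
move=> slope g0 eps0; have gi0 : 0 < gamma^-1 by rewrite invr_gt0.
have [z z0 [X X0 HX]] := log_slope_ratio slope gi0 eps0.
exists (gamma * z); first by rewrite mulr_gt0.
have [N HN] := natr_eventually_ge X; exists N => m n /HN Xm h.
have := HX m%:R n%:R Xm; rewrite lnV ?posrE// mulrN opprK; apply.
rewrite -(ler_pM2l g0) mulrA (le_trans _ h)//.
rewrite -[X in X * `|_|](gtr0_norm g0) -normrM mulrBr mulrA mulfV ?mul1r//.
by rewrite gt_eqF.
Qed.

(** Rounding allows an error [1/2] in [gamma n + g n]; division by [gamma] turns it into
    [1 / (2 * gamma)]. *)
Lemma phase_of_attained (R : realType) (g : R -> R) (lambda gamma eta : R) :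
  log_slope g lambda -> 0 < gamma -> 0 < eta ->
  exists M : nat, forall m : nat, (M <= m)%N -> attained gamma g m ->
    dist_int (phase gamma lambda g m) <= 1 / (2 * gamma) + eta.
Proof.
move=> slope g0 eta0.
have [z z0 [M1 HM1]] := log_slope_near_index slope g0 (mulr_gt0 g0 eta0).
(* The first bound yields [gamma * n <= 4 * m]; the second then gives [|g n| <= z * m / 2]. *)
pose e := Num.min (gamma / 2) (z * gamma / 8).
have e0 : 0 < e by rewrite lt_min !divr_gt0// mulr_gt0.
have [X X0 HX] := log_slope_sublinear slope e0.
have [N HN] := natr_eventually_ge X; have [N' HN'] := natr_eventually_ge z^-1.
(* An [m] above [C + 1] cannot come from an index below [N]. *)
have [C HC] := bounded_prefix (fun n => gamma * n%:R + g n%:R) N.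
exists (M1 + C.+2 + N')%N => m Mm [n _ /eqP].
rewrite eq_sym => /eqP nE; have /andP[n1 n2] := nearest_int_itv (gamma * n%:R + g n%:R).
rewrite -nE -[m%:Z%:~R]/(m%:R) in n1 n2.
have Xn : X <= n%:R.
  apply: HN; rewrite leqNgt; apply/negP => /HC.
  have : C%:R + 1 <= m%:R :> R by rewrite natr1 ler_nat; clear - Mm; lia.
  lra.
have gn := HX _ Xn.
have zm : 1 <= z * m%:R.
  rewrite -ler_pdivrMl// mulr1; apply: HN'; clear - Mm; lia.
have m1 : 1 <= m%:R :> R by rewrite ler1n; clear - Mm; lia.
have n0 : 0 <= n%:R :> R by [].
have e1 : e * n%:R <= gamma / 2 * n%:R by rewrite ler_wpM2r// ge_min lexx.
have e2 : e * n%:R <= z * gamma / 8 * n%:R.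
  by rewrite ler_wpM2r// ge_min lexx orbT.
have gn' := gn; rewrite ler_norml in gn.
have nm : gamma * n%:R <= 4 * m%:R by lra.
have znm : z * (gamma * n%:R) <= z * (4 * m%:R) by rewrite ler_pM2l.
have near : `|gamma * n%:R - m%:R| <= z * m%:R by rewrite ler_norml; lra.
have h := HM1 m n ltac:(clear - Mm; lia) near; rewrite ler_norml in h.
apply: le_trans (dist_int_le _ n%:Z) _; rewrite -[n%:Z%:~R]/(n%:R) /phase.
have -> : (m%:R - g m%:R + lambda * ln gamma) / gamma - n%:R =
  (m%:R - g m%:R + lambda * ln gamma - gamma * n%:R) / gamma by field; lra.
rewrite normrM normfV (gtr0_norm g0) ler_pdivrMr//.
have -> : (1 / (2 * gamma) + eta) * gamma = 1 / 2 + gamma * eta by field; lra.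
by rewrite ler_norml; lra.
Qed.

(** By contraposition: an integer [k] closer to the phase than the bound is an index at which [m] is
    attained. *)
Lemma phase_of_missed (R : realType) (g : R -> R) (lambda gamma eta : R) :
  log_slope g lambda -> 0 < gamma -> 0 < eta ->
  exists M : nat, forall m : nat, (M <= m)%N -> ~ attained gamma g m ->
    1 / (2 * gamma) - eta <= dist_int (phase gamma lambda g m).
Proof.
move=> slope g0 eta0.
have ge0 : 0 < gamma * eta / 2 by rewrite divr_gt0// mulr_gt0.
have [z z0 [M1 HM1]] := log_slope_near_index slope g0 ge0.
(* The bound [1/2] gives [gamma * k >= m / 2], so the integer [k] is a positive index. *)
pose z' := Num.min z (1 / 2).
have z'0 : 0 < z' by rewrite lt_min z0; lra.
have z'2 : 0 < z' / 2 by lra.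
have [X X0 HX] := log_slope_sublinear slope z'2.
pose C := gamma / 2 + `|lambda * ln gamma|.
have [N HN] := natr_eventually_ge X.
have [N' HN'] := natr_eventually_ge (2 * C / z').
exists (M1 + N + N')%N => m Mm miss.
rewrite leNgt; apply/negP => small; apply: miss.
have Xm : X <= m%:R by apply: HN; clear - Mm; lia.
have Cm : C <= z' / 2 * m%:R.
  have : 2 * C / z' <= m%:R by apply: HN'; clear - Mm; lia.
  by rewrite ler_pdivrMr//; lra.
have gm := HX _ Xm.
have [k ek k2] := dist_intE (phase gamma lambda g m); rewrite ek in small.
have pE : gamma * phase gamma lambda g m = m%:R - g m%:R + lambda * ln gamma.
  by rewrite /phase; field; lra.
have gk2 : `|gamma * phase gamma lambda g m - gamma * k%:~R| <= gamma / 2.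
  have -> : gamma / 2 = gamma * (1 / 2) by field.
  by rewrite -mulrBr normrM (gtr0_norm g0) ler_pM2l.
have near : `|gamma * k%:~R - m%:R| <= z' * m%:R.
  have -> : gamma * k%:~R - m%:R = - (gamma * phase gamma lambda g m - gamma * k%:~R)
    - g m%:R + lambda * ln gamma by rewrite pE; ring.
  apply: le_trans (ler_normD _ _) _.
  have := ler_normB (- (gamma * phase gamma lambda g m - gamma * k%:~R)) (g m%:R).
  by rewrite normrN /C in Cm *; lra.
have m0 : 0 < m%:R :> R by lra.
have z'z : z' * m%:R <= z * m%:R by rewrite ler_pM2r// ge_min lexx.
have z'h : z' * m%:R <= 1 / 2 * m%:R by rewrite ler_pM2r// ge_min lexx orbT.
have k0 : 0 < k.
  rewrite -(ltr_int R) -(pmulr_rgt0 _ g0).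
  by move: near; rewrite ler_norml; lra.
have kE : k = `|k|%N%:Z by clear - k0; lia.
move: kE; set n := `|k|%N => kE; rewrite kE -[n%:Z%:~R]/(n%:R) in near small.
exists n; first by rewrite /posnat/= -ltz_nat -kE.
have h := HM1 m n ltac:(clear - Mm; lia) (le_trans near z'z).
apply/nearest_intP; rewrite -[m%:Z%:~R]/(m%:R).
have : `|gamma * phase gamma lambda g m - gamma * n%:R| < 1 / 2 - gamma * eta.
  rewrite -mulrBr normrM (gtr0_norm g0).
  have -> : 1 / 2 - gamma * eta = gamma * (1 / (2 * gamma) - eta) by field; lra.
  by rewrite ltr_pM2l.
rewrite pE; move: h; rewrite ler_norml ltr_norml => h1 h2; lra.
Qed.

(** * Slope at most one *)

Lemma first_crossing (R : realType) (a : nat -> R) (n1 : nat) (T : R) :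
  a n1 < T -> (exists2 n : nat, (n1 <= n)%N & T <= a n) ->
  exists2 n : nat, (n1 <= n)%N & a n < T <= a n.+1.
Proof.
move=> an1 [n n1n Tn]; pose P k := (n1 <= k)%N && (T <= a k).
have exP : exists k, P k by exists n; rewrite /P n1n.
case: (ex_minnP exP) => -[|k] /andP[n1k Tk] kmin.
  by move: n1k; rewrite leqn0 => /eqP n10; move: an1; rewrite n10; lra.
have [kn1|n1k'] := ltnP k n1.
  have e : k.+1 = n1 by clear - n1k kn1; lia.
  by move: an1; rewrite -e; lra.
exists k => //; rewrite Tk andbT ltNge; apply/negP => Tk'.
have := kmin k; rewrite /P n1k' Tk' ltnn => h.
by have := h isT.
Qed.

(** A step of length at most [1] cannot jump over the half-open interval of length [1] that rounds
    to [m]. *)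
Lemma cofinite_of_small_steps (R : realType) (a : nat -> R) :
  (exists N0 : nat, forall n, (N0 <= n)%N -> a n.+1 <= a n + 1) ->
  (forall C : R, exists N : nat, forall n, (N <= n)%N -> C <= a n) ->
  exists M : nat, forall m : nat, (M <= m)%N ->
    exists2 n : nat, posnat n & nearest_int (a n) = m%:Z.
Proof.
move=> [N0 step] infty; pose n1 := N0.+1.
have [M HM] := natr_eventually_ge (a n1 + 1); exists M => m /HM Mm.
have [N HN] := infty (m%:R - 1 / 2).
have [|| n n1n /andP[h1 h2]] := @first_crossing _ a n1 (m%:R - 1 / 2).
- lra.
- by exists (maxn n1 N); [rewrite leq_maxl|apply: HN; rewrite leq_maxr].
exists n.+1 => //; apply/nearest_intP; rewrite -[m%:Z%:~R]/(m%:R) h2/=.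
by have := step n (ltnW n1n); lra.
Qed.

Lemma missed_crossing (R : realType) (a : nat -> R) (m : nat) (n1 : nat) :
  (0 < n1)%N -> a n1 < m%:R - 1 / 2 ->
  (exists2 n : nat, (n1 <= n)%N & m%:R - 1 / 2 <= a n) ->
  ~ (exists2 n : nat, posnat n & nearest_int (a n) = m%:Z) ->
  exists2 n : nat, (n1 <= n)%N & a n < m%:R - 1 / 2 /\ m%:R + 1 / 2 <= a n.+1.
Proof.
move=> n10 h1 /(first_crossing h1)[n n1n /andP[h2 h3]] miss.
exists n => //; split=> //; rewrite leNgt; apply/negP => h4; apply: miss.
by exists n.+1 => //; apply/nearest_intP; rewrite -[m%:Z%:~R]/(m%:R) h3.
Qed.

(** For [gamma < 1], or [gamma = 1] with [g] nonincreasing, steps are eventually at most [1] and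
    every large [x + x] is attained. For [gamma = 1] with [g] nondecreasing, steps are at least [1]
    and some integers may be missed; but if both [m] and [m + h] were missed, then [g] would
    increase by more than [1] over at most [h] indices. *)
Lemma slope_le1_sums_attained (R : realType) (g : R -> R) (lambda gamma : R)
  (A : set nat) :
  log_slope g lambda -> 0 <= gamma <= 1 ->
  (exists X : R, forall x y, X <= x -> x <= y -> g x <= g y) \/
  (exists X : R, forall x y, X <= x -> x <= y -> g y <= g x) ->
  (forall C : R, exists N : nat, forall n : nat,
     (N <= n)%N -> C <= gamma * n%:R + g n%:R) ->
  (0 < upper_density R A)%E ->
  exists x y : nat, [/\ A x, A y & attained gamma g (x + y)].
Proof.
move=> slope /andP[g0 g1] mono infty dens; pose a n := gamma * n%:R + g n%:R.
have [h h0 Ah] := upper_density_gt0_common_difference dens.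
have [x0 _ [Ax0 _]] := Ah 0%N.
have cof : (exists N0 : nat, forall n, (N0 <= n)%N -> a n.+1 <= a n + 1) ->
    exists x y : nat, [/\ A x, A y & attained gamma g (x + y)].
  move=> /cofinite_of_small_steps/(_ infty)[M HM]; have [x Mx [Ax _]] := Ah M.
  exists x, x; split=> //.
  by have := HM (x + x)%N (leq_trans Mx (leq_addr _ _)).
have [g1'|g1'] := ltP gamma 1.
  apply: cof; have e0 : 0 < 1 - gamma by lra.
  have [X X0 HX] := log_slope_small_step 1 slope e0.
  have [N HN] := natr_eventually_ge X; exists N => n /HN Xn.
  have := HX n%:R n.+1%:R Xn; rewrite -natr1 addrAC subrr add0r normr1 lexx.
  by move=> /(_ isT); rewrite ler_norml /a -natr1; lra.
have {g0 g1 g1'}gE : gamma = 1 by lra.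
case: mono => -[X mono]; last first.
  apply: cof; have [N HN] := natr_eventually_ge X; exists N => n /HN Xn.
  have := mono n%:R n.+1%:R Xn; rewrite ler_nat => /(_ (leqnSn n)).
  by rewrite /a gE -natr1; lra.
apply: contrapT => none.
have miss x : A x -> ~ attained gamma g (x + x0).
  by move=> Ax att; apply: none; exists x, x0.
have [Y Y0 HY] := log_slope_small_step h%:R slope ltr01.
have [N HN] := natr_eventually_ge (Num.max X Y); pose n1 := N.+1.
have [M HM] := natr_eventually_ge (a n1 + 1).
(* Both [m = x + x0] and [m + h = (x + h) + x0] are sums of elements of [A], with [x0] fixed. *)
have [x Mx [Ax Axh]] := Ah M; pose m := (x + x0)%N.
have Mm := HM m (leq_trans Mx (leq_addr _ _)).
have large (T : R) : exists2 n, (n1 <= n)%N & T <= a n.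
  have [N' HN'] := infty T; exists (maxn n1 N'); first by rewrite leq_maxl.
  by apply: HN'; rewrite leq_maxr.
have [n n1n [h1 h2]] := @missed_crossing _ a m n1 isT ltac:(lra) (large _)
  (miss x Ax).
have mh : (m + h)%:R = m%:R + h%:R :> R by rewrite natrD.
have missh : ~ exists2 n, posnat n & nearest_int (a n) = (m + h)%N%:Z.
  by have := miss _ Axh; rewrite /m addnAC.
have hh : 1 <= h%:R :> R by rewrite ler1n.
have [n' n1n' [h1' h2']] := @missed_crossing _ a (m + h) n1 isT
  ltac:(rewrite mh; lra) (large _) missh.
rewrite mh in h1' h2'.
have XN k : (n1 <= k)%N -> X <= k%:R /\ Y <= k%:R.
  by move=> n1k; apply/ler_max2/HN; exact: ltnW.
have amono i j : (n1 <= i <= j)%N -> a i + (j - i)%:R <= a j.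
  move=> /andP[n1i ij]; have [Xi _] := XN _ n1i.
  by have := mono _ _ Xi (_ : i%:R <= j%:R); rewrite ler_nat => /(_ ij);
    rewrite /a gE natrB//; lra.
have nn' : (n <= n')%N.
  rewrite leqNgt; apply/negP => n'n.
  have := amono n'.+1 n; rewrite n'n (leq_trans n1n' (leqnSn _)) => /(_ isT).
  have : 0 <= (n - n'.+1)%:R :> R by [].
  lra.
have n'h : (n' < n + h)%N.
  move: nn'; rewrite leq_eqVlt => /orP[/eqP <-|nn'].
    by rewrite -[ltnLHS]addn0 ltn_add2l.
  have := amono n.+1 n'; rewrite nn' (leq_trans n1n (leqnSn _)) => /(_ isT) h3.
  have : (n' - n.+1)%:R + 1 < h%:R :> R by lra.
  by rewrite natr1 ltr_nat; clear - nn'; lia.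
have [Xn Yn] := XN _ n1n.
have n'hR : n'.+1%:R - n%:R <= h%:R :> R.
  by rewrite -natrB ?ler_nat; [clear - n'h; lia|clear - nn'; lia].
have nn'R : n%:R <= n'%:R :> R by rewrite ler_nat.
have := HY n%:R n'.+1%:R Yn; rewrite ger0_norm; last by rewrite -natr1; lra.
move=> /(_ n'hR); rewrite ler_norml => /andP[_].
by move: h1 h2'; rewrite /a gE !mul1r; lra.
Qed.

(** * Attained sums for slope above one *)

(** One element of [A] is kept for each colour. It supplies a [y] with [y / gamma] close to
    [x / gamma] modulo [1], yet bounded, so that [g (x + y)] stays close to [g x]. *)
Lemma bounded_representatives (A : set nat) (T : finType) (f : nat -> T) :
  exists Y : nat, forall x, A x -> exists y, [/\ A y, (y <= Y)%N & f y = f x].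
Proof.
have rep (i : T) : exists Y : nat, (exists2 x, A x & f x = i) ->
    A Y /\ f Y = i.
  have [[x Ax fx]|none] := pselect (exists2 x, A x & f x = i); last by exists 0%N.
  by exists x.
have [F HF] := choice rep; exists (\max_i F i)%N => x Ax; exists (F (f x)).
have [|AF fF] := HF (f x); first by exists x.
by split=> //; exact: leq_bigmax.
Qed.

(* If no sum of two elements of [A] is attained then, for large [x] in [A],
   [s = (2 x - g x + lambda ln gamma) / gamma] is the phase of [x + y], up to
   an integer, for a suitable bounded [y] in [A], whereas the phase of [2 x] is
   [s - lambda ln 2 / gamma]. *)
Lemma missed_sums_phase (R : realType) (g : R -> R) (lambda gamma eta : R)
  (A : set nat) :
  log_slope g lambda -> 0 < gamma -> 0 < eta ->
  1 - 1 / gamma <= dist_int (lambda * ln 2 / gamma) ->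
  (forall x y, A x -> A y -> ~ attained gamma g (x + y)) ->
  exists X : nat, forall x : nat, (X <= x)%N -> A x ->
    dist_int (2 * ((2 * x%:R - g x%:R + lambda * ln gamma) / gamma) -
              lambda * ln 2 / gamma) <= 2 * eta.
Proof.
move=> slope g0 eta0 extremal miss.
have eta2 : 0 < eta / 2 by lra. have eta4 : 0 < eta / 4 by lra.
have geta : 0 < gamma * (eta / 2) by rewrite mulr_gt0.
have geta4 : 0 < gamma * (eta / 4) by rewrite mulr_gt0.
have [M HM] := phase_of_missed slope g0 eta2.
have [z z0 [X1 X10 HX1]] := log_slope_ratio slope (ltr0Sn R 1) geta.
have [K [cell cellP]] := circle_cells eta4.
have [Y HY] := bounded_representatives A (fun x : nat => cell (x%:R / gamma)).
have [X2 X20 HX2] := log_slope_small_step Y%:R slope geta4.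
have [N HN] := natr_eventually_ge (Num.max X1 X2).
exists (M + N)%N => x MNx Ax.
have [X1x X2x] : X1 <= x%:R /\ X2 <= x%:R.
  by apply/ler_max2/HN; apply: leq_trans MNx; rewrite leq_addl.
have Mx : (M <= x)%N by apply: leq_trans MNx; rewrite leq_addr.
set s := (_ + _) / gamma.
have h1 : 1 / 2 - (1 - 1 / gamma) / 2 - eta <= dist_int (s - lambda * ln 2 / gamma).
  have := HM (x + x)%N (leq_trans Mx (leq_addr _ _)) (miss _ _ Ax Ax).
  have gx := HX1 x%:R (x + x)%:R X1x.
  have := dist_int_lipschitz (phase gamma lambda g (x + x))
    (s - lambda * ln 2 / gamma).
  have -> : phase gamma lambda g (x + x) - (s - lambda * ln 2 / gamma) =
      - (g (x + x)%:R - g x%:R - lambda * ln 2) / gamma.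
    by rewrite /phase /s natrD; field; lra.
  rewrite normrM normrN normfV (gtr0_norm g0).
  have : `|g (x + x)%:R - g x%:R - lambda * ln 2| / gamma <= eta / 2.
    rewrite ler_pdivrMr// [eta / 2 * _]mulrC; apply: gx.
    have -> : (x + x)%:R - 2 * x%:R = 0 :> R by rewrite natrD; ring.
    by rewrite normr0 mulr_ge0// ltW.
  have -> : 1 / (2 * gamma) = 1 / 2 - (1 - 1 / gamma) / 2 by field; lra.
  lra.
apply: dist_int_extremal h1 extremal.
have [y [Ay yY cxy]] := HY x Ax.
have := HM (x + y)%N (leq_trans Mx (leq_addr _ _)) (miss _ _ Ax Ay).
have gxy : `|g (x + y)%:R - g x%:R| <= gamma * (eta / 4).
  by apply: HX2 => //; rewrite natrD addrAC subrr add0r ger0_norm ?ler_nat.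
have := dist_int_lipschitz
  (phase gamma lambda g (x + y) - (y%:R / gamma - x%:R / gamma)) s.
have -> : phase gamma lambda g (x + y) - (y%:R / gamma - x%:R / gamma) - s =
    - (g (x + y)%:R - g x%:R) / gamma.
  by rewrite /phase /s natrD; field; lra.
rewrite normrM normrN normfV (gtr0_norm g0).
have : `|g (x + y)%:R - g x%:R| / gamma <= eta / 4 by rewrite ler_pdivrMr// mulrC.
have := cellP _ _ cxy.
have := dist_int_add (phase gamma lambda g (x + y) - (y%:R / gamma - x%:R / gamma))
  (y%:R / gamma - x%:R / gamma).
rewrite subrK.
have -> : 1 / (2 * gamma) = 1 / 2 - (1 - 1 / gamma) / 2 by field; lra.
lra.
Qed.

Lemma log_slope_sums_attained (R : realType) (g : R -> R) (lambda gamma : R)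
  (A : set nat) :
  log_slope g lambda -> 1 < gamma ->
  1 - 1 / gamma <= dist_int (lambda * ln 2 / gamma) ->
  (0 < upper_density R A)%E ->
  exists x y : nat, [/\ A x, A y & attained gamma g (x + y)].
Proof.
move=> slope g1 extremal dens; apply: contrapT => none.
have g0 : 0 < gamma by lra.
have miss x y : A x -> A y -> ~ attained gamma g (x + y).
  by move=> Ax Ay att; apply: none; exists x, y.
(* For [lambda = 0] the distance in [extremal] is [0], whereas [1 - 1 / gamma > 0]. *)
have lam0 : lambda != 0.
  apply/eqP => l0; move: extremal; rewrite l0 !mul0r.
  have -> : dist_int (0 : R) = 0 by rewrite -[0 in LHS]/(0%:~R) dist_int_intr.
  by rewrite lerBlDr add0r ler_pdivlMr// mul1r; lra.
have phase_cv eta : 0 < eta -> _ :=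
  fun eta0 => missed_sums_phase slope g0 eta0 extremal miss.
set d := lambda * ln 2 / gamma in extremal phase_cv.
pose s (x : nat) := (2 * x%:R - g x%:R + lambda * ln gamma) / gamma.
have {}phase_cv eta : 0 < eta -> exists X : nat, forall x : nat, (X <= x)%N ->
    A x -> dist_int (2 * s x - d) <= 2 * eta := phase_cv eta.
have [h h0 Ah] := upper_density_gt0_common_difference dens.
have h0R : 0 < h%:R :> R by rewrite ltr0n.
(* Compare the pinned values at [x] and [x + h]: [g] hardly changes, so [4 * h / gamma] is
   arbitrarily close to the integers. *)
have [w hw] : exists w : int, 4 * h%:R / gamma = w%:~R.
  apply: dist_int_eq0; apply/eqP; rewrite eq_le dist_int_ge0 andbT leNgt.
  apply/negP => pos; pose eta := dist_int (4 * h%:R / gamma) / 8.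
  have eta0 : 0 < eta by rewrite divr_gt0.
  have geta0 : 0 < gamma * eta by rewrite mulr_gt0.
  have [X HX] := phase_cv _ eta0.
  have [Y Y0 HY] := log_slope_small_step h%:R slope geta0.
  have [N HN] := natr_eventually_ge Y.
  have [x XNx [Ax Axh]] := Ah (X + N)%N.
  have Xx : (X <= x)%N by apply: leq_trans XNx; rewrite leq_addr.
  have Yx : Y <= x%:R by apply: HN; apply: leq_trans XNx; rewrite leq_addl.
  have d1 := HX x Xx Ax; have d2 := HX _ (leq_trans Xx (leq_addr h x)) Axh.
  have gh : `|g (x + h)%:R - g x%:R| <= gamma * eta.
    by apply: HY => //; rewrite natrD addrAC subrr add0r ger0_norm.
  have := dist_int_lipschitz (4 * h%:R / gamma) ((2 * s (x + h)%N - d) - (2 * s x - d)).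
  have := dist_int_add (2 * s (x + h)%N - d) (- (2 * s x - d)).
  rewrite dist_intN.
  have -> : 4 * h%:R / gamma - (2 * s (x + h)%N - d - (2 * s x - d)) =
     2 * (g (x + h)%:R - g x%:R) / gamma.
    by rewrite /s natrD; field; lra.
  rewrite normrM normrM normfV (gtr0_norm g0) (@ger0_norm _ 2)//.
  have : 2 * `|g (x + h)%:R - g x%:R| / gamma <= 2 * eta.
    by rewrite ler_pdivrMr// -mulrA [eta * _]mulrC ler_pM2l.
  have -> : dist_int (4 * h%:R / gamma) = 8 * eta by rewrite /eta; field.
  lra.
have l0 : 0 < `|lambda| by rewrite normr_gt0.
pose nu := 2 * h%:R / gamma * `|lambda|.
have hg : 0 < 2 * h%:R / gamma by rewrite divr_gt0// mulr_gt0.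
have nu0 : 0 < nu by rewrite mulr_gt0.
have l2 : 0 < `|lambda| / 2 by lra.
have [Z Z0 HZ] := slope _ l2.
(* This ratio keeps [2 * h / gamma * (g y - g x)] within [1/2] of [0], where [dist_int] is the
   absolute value. *)
apply: (@upper_density_le0_of_log_gaps R A (expR (1 / (3 * nu)))) => //.
  by rewrite expR_gt1 divr_gt0// mulr_gt0.
move=> rho rho1; have lrho : 0 < ln rho by exact: ln_gt0.
(* After multiplication by [h] the two pinning errors add up to [nu / 4 * ln rho], below the lower
   bound [nu / 2 * ln rho]. *)
pose eta := nu * ln rho / (16 * h%:R).
have eta0 : 0 < eta by apply: divr_gt0; apply: mulr_gt0.
have [X HX] := phase_cv _ eta0; have [N HN] := natr_eventually_ge Z.
exists (X + N)%N => x y XNx Ax Ay xy yx.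
have Xx : (X <= x)%N by apply: leq_trans XNx; rewrite leq_addr.
have Zx : Z <= x%:R by apply: HN; apply: leq_trans XNx; rewrite leq_addl.
have x0 : 0 < x%:R :> R by lra.
have xyR : x%:R < y%:R :> R by apply: lt_le_trans xy; rewrite ltr_pMl.
have xyN : (x < y)%N by rewrite -(ltr_nat R).
have y0 : 0 < y%:R :> R by lra.
have r0 : 0 < rho by lra.
have lo : ln rho <= ln y%:R - ln x%:R.
  by rewrite lerBrDr -lnM ?posrE// ler_ln ?posrE// mulr_gt0.
have hi : ln y%:R - ln x%:R <= 1 / (3 * nu).
  rewrite lerBlDr -[X in X + _]expRK -lnM ?posrE ?expR_gt0// ler_ln ?posrE//.
  by rewrite mulr_gt0// expR_gt0.
have gap := HZ _ _ Zx (ltW xyR).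
set t := ln y%:R - ln x%:R in lo hi gap.
have t0 : 0 < t by lra.
set Dg := g y%:R - g x%:R in gap.
have lt : `|lambda * t| = `|lambda| * t by rewrite normrM (gtr0_norm t0).
have Dlo : `|lambda| / 2 * t <= `|Dg|.
  by have := lerB_dist (lambda * t) Dg; rewrite (distrC _ Dg) lt; lra.
have Dhi : `|Dg| <= 3 / 2 * `|lambda| * t.
  by have := lerB_dist Dg (lambda * t); rewrite lt; lra.
have nE : `|2 * h%:R / gamma * Dg| = 2 * h%:R / gamma * `|Dg|.
  by rewrite normrM (gtr0_norm hg).
have nlo : nu / 2 * ln rho <= `|2 * h%:R / gamma * Dg|.
  rewrite nE; apply: (@le_trans _ _ (2 * h%:R / gamma * (`|lambda| / 2 * t))).
    have -> : 2 * h%:R / gamma * (`|lambda| / 2 * t) = nu / 2 * t.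
      by rewrite /nu; field; lra.
    by rewrite ler_pM2l//; lra.
  by rewrite ler_pM2l.
have nhi : `|2 * h%:R / gamma * Dg| <= 1 / 2.
  rewrite nE; apply: (@le_trans _ _ (2 * h%:R / gamma * (3 / 2 * `|lambda| * t))).
    by rewrite ler_pM2l.
  have -> : 2 * h%:R / gamma * (3 / 2 * `|lambda| * t) = 3 / 2 * nu * t.
    by rewrite /nu; field; lra.
  have : 3 / 2 * nu * t <= 3 / 2 * nu * (1 / (3 * nu)) by rewrite ler_pM2l//; lra.
  by have -> : 3 / 2 * nu * (1 / (3 * nu)) = 1 / 2 by field; lra.
have := dist_int_small nhi.
have dy := HX y (leq_trans Xx (ltnW xyN)) Ay; have dx := HX x Xx Ax.
have hy := le_trans (dist_int_mulrn h _) (ler_wpM2l (ler0n _ h) dy).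
have hx := le_trans (dist_int_mulrn h _) (ler_wpM2l (ler0n _ h) dx).
have := dist_int_add (h%:R * (2 * s y - d)) (- (h%:R * (2 * s x - d))).
have -> : h%:R * (2 * s y - d) - h%:R * (2 * s x - d) =
    - (2 * h%:R / gamma * Dg) + (w * (y - x)%N%:Z)%:~R.
  rewrite intrM -hw -[(y - x)%N%:~R]/((y - x)%:R) natrB ?(ltnW xyN)//.
  by rewrite /s /Dg; field; lra.
rewrite dist_intDz !dist_intN => h1 h2.
have he : h%:R * (2 * eta) = nu / 8 * ln rho by rewrite /eta; field; lra.
rewrite he in hx hy.
have : 0 < nu * ln rho by rewrite mulr_gt0.
lra.
Qed.

(** * Sets without attained sums *)

(** A sequence with vanishing steps that is unbounded above must cross some [tau + k], and it lands
    within one step of it. *)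
Lemma slow_sequence_dense (R : realType) (f : nat -> R) (tau eps : R) (M : nat) :
  (forall e : R, 0 < e -> exists N : nat, forall n, (N <= n)%N ->
     `|f n.+1 - f n| < e) ->
  (forall (T : R) (N : nat), exists2 n : nat, (N <= n)%N & T <= f n) ->
  0 < eps -> exists2 N : nat, (M <= N)%N & dist_int (f N - tau) < eps.
Proof.
move=> slow unb eps0; have [N0 HN0] := slow _ eps0; pose M' := maxn M N0.
pose k := Num.ceil (f M' - tau) + 1.
have fk : f M' < tau + k%:~R.
  by have := ceil_ge (f M' - tau); rewrite /k intrD; lra.
have [n M'n /andP[h1 h2]] := first_crossing fk (unb _ _).
have [Mn N0n] : (M <= n)%N /\ (N0 <= n)%N by apply/andP; rewrite -geq_max.
exists n.+1; first exact: leq_trans Mn (leqnSn n).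
apply: le_lt_trans (dist_int_le _ k) _.
by have := HN0 _ N0n; rewrite !ltr_norml; lra.
Qed.

Lemma count_iota_sub (p : pred nat) (M n N : nat) : (0 < M)%N ->
  (M + n <= N.+1)%N -> (count p (iota M n) <= count p (iota 1 N))%N.
Proof.
move=> M0 MnN; have -> : N = (N.+1 - 1)%N by lia.
rewrite (@count_iota_cat _ 1 M); last by lia.
rewrite (@count_iota_cat _ M (M + n)); last by lia.
have -> : (M + n - M = n)%N by lia.
by rewrite addnCA leq_addr.
Qed.

(** [F] is not assumed monotone, so each new term is taken above the maximum of [F] on the whole
    interval up to the previous term. *)
Lemma sparse_subsequence (S : nat -> Prop) (F : nat -> nat) (B : nat) :
  (forall M, exists2 N : nat, (M <= N)%N & S N) ->
  exists N : nat -> nat, [/\ forall k, S (N k), forall k, (B + k <= N k)%N &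
    forall j k, (j < k)%N -> (F (N j) <= N k)%N].
Proof.
move=> unb.
have ex M : exists n, (M <= n)%N /\ S n by have [n] := unb M; exists n.
have [f Hf] := choice ex.
pose N := fix N k :=
  if k is k'.+1 then f (N k' + F (N k') + \max_(i < (N k').+1) F i).+1%N
  else f B.
have NS k : (N k < N k.+1)%N.
  by apply: leq_trans (Hf _).1; rewrite ltnS -addnA leq_addr.
have NF k i : (i <= N k)%N -> (F i <= N k.+1)%N.
  move=> ik; apply: leq_trans (Hf _).1; apply: leq_trans (leqnSn _).
  apply: leq_trans (leq_addl _ _).
  exact: (@leq_bigmax _ (fun i : 'I_(N k).+1 => F i) (Ordinal (ik : (i < (N k).+1)%N))).
have Nmono j k : (j <= k)%N -> (N j <= N k)%N.
  elim: k => [|k IHk]; first by rewrite leqn0 => /eqP ->.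
  rewrite leq_eqVlt => /orP[/eqP -> //|jk].
  exact: leq_trans (IHk jk) (ltnW (NS k)).
exists N; split=> [[|k]|k|j [//|k] jk].
- exact: (Hf B).2.
- exact: (Hf _).2.
- elim: k => [|k IHk]; first by rewrite addn0; exact: (Hf B).1.
  by rewrite addnS; exact: leq_ltn_trans (NS k).
- exact/NF/Nmono.
Qed.

(* [A] is a Bohr set intersected with sparse windows [(1 - z) N, N] along which
   [g N / gamma] is close to [tau] modulo [1]: two elements of one window have
   phase [s - lambda ln 2 / gamma], elements of distinct windows have phase
   [s]. *)
Lemma sums_missed_of_phases (R : realType) (g : R -> R) (lambda gamma u tau : R) :
  log_slope g lambda -> 1 < gamma ->
  (forall (e : R) (M : nat), 0 < e ->
     exists2 N : nat, (M <= N)%N & dist_int (g N%:R / gamma - tau) < e) ->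
  (forall e : R, 0 < e -> exists2 L : nat, (0 < L)%N & forall M : nat,
     exists2 x : nat, (M <= x < M + L)%N & dist_int (x%:R / gamma - u) < e) ->
  let s := 2 * u - tau + lambda * ln gamma / gamma in
  1 / (2 * gamma) < dist_int s ->
  1 / (2 * gamma) < dist_int (s - lambda * ln 2 / gamma) ->
  exists A : set nat, [/\ A `<=` posnat, (0 < upper_density R A)%E &
    forall x y, A x -> A y -> ~ attained gamma g (x + y)].
Proof.
move=> slope g1 dense bohr s s1 s2; have g0 : 0 < gamma by lra.
set d := lambda * ln 2 / gamma in s2.
(* Five errors of size [e] occur: one from the phase bound, two from the Bohr condition, one from
   [tau] and one from the slope. A sixth of the slack leaves a strict inequality. *)
pose e : R := Num.min (dist_int s - 1 / (2 * gamma))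
  (dist_int (s - d) - 1 / (2 * gamma)) / 6.
have e0 : 0 < e by rewrite divr_gt0// lt_min !subr_gt0 s1.
have [e1 e2] : 1 / (2 * gamma) + 6 * e <= dist_int s /\
    1 / (2 * gamma) + 6 * e <= dist_int (s - d).
  have : 6 * e <= Num.min (dist_int s - 1 / (2 * gamma))
      (dist_int (s - d) - 1 / (2 * gamma)) by rewrite /e; lra.
  by rewrite le_min => /andP[]; lra.
move: e e0 e1 e2 => e e0 e1 e2.
have ge0 : 0 < gamma * e by rewrite mulr_gt0.
have [M0 HM0] := phase_of_attained slope g0 e0.
have [z1 z10 [X1 X10 HX1]] := log_slope_ratio slope ltr01 ge0.
have [z2 z20 [X2 X20 HX2]] := log_slope_ratio slope (ltr0Sn R 1) ge0.
(* [z <= z1] serves sums across two windows, close to [N k]; [2 * z <= z2] serves sums within one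
   window, close to [2 * N k]; [z <= 1/2] keeps the elements of a window above [N k / 2]. *)
have [z [z0 z_half zz1 zz2]] : exists z : R,
    [/\ 0 < z, z <= 1 / 2, z <= z1 & 2 * z <= z2].
  exists (Num.min (1 / 2) (Num.min z1 (z2 / 2))); split.
  - by rewrite !lt_min z10 divr_gt0//= divr_gt0.
  - by rewrite ge_min lexx.
  - by rewrite !ge_min lexx orbT.
  - by rewrite mulrC -ler_pdivlMr// !ge_min lexx !orbT.
have [B HB] := natr_eventually_ge (Num.max X1 X2).
pose F (N : nat) := (Num.truncn (N%:R / z)).+1.
have [N [NS NB NF]] := @sparse_subsequence
  (fun N => dist_int (g N%:R / gamma - tau) < e) F B (fun M => dense e M e0).
have NX k : X1 <= (N k)%:R /\ X2 <= (N k)%:R.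
  by apply/ler_max2/HB; apply: leq_trans (NB k); rewrite leq_addr.
have Nsparse j k : (j < k)%N -> (N j)%:R <= z * (N k)%:R.
  move=> /NF Fk; rewrite mulrC -ler_pdivrMr//; apply: le_trans (ltW (truncnS_gt _)) _.
  by rewrite ler_nat.
pose W k (x : nat) : bool :=
  let t : R := x%:R in (1 - z) * (N k)%:R <= t <= (N k)%:R.
pose A : set nat := [set x | [/\ posnat x, (M0 <= x)%N,
  dist_int (x%:R / gamma - u) < e &
  exists k, W k x]].
exists A; split.
- by move=> x [].
- have [L L0 HL] := bohr e e0.
  have L0R : 0 < L%:R :> R by rewrite ltr0n.
  (* A window of length [z * N] contains more than [z * N / L - 1] disjoint blocks of length [L],
     each with a Bohr point, and the loss of [1] is at most half of this once [2 * L <= z * N]. *)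
  apply/upper_density_gt0; exists (z / (2 * L%:R)).
    by rewrite divr_gt0 ?mulr_gt0.
  move=> N0; have [N1 HN1] := natr_eventually_ge (2 * L%:R / z).
  pose k := (N0 + N1 + 2 * M0).+1; exists (N k).
    apply: leq_trans (NB k); rewrite /k; clear; lia.
  have Nk1 : 2 * L%:R <= z * (N k)%:R.
    rewrite [leRHS]mulrC -ler_pdivrMr//; apply: HN1.
    by apply: leq_trans (NB k); rewrite /k; clear; lia.
  have Nk2 : 2 * M0%:R <= (N k)%:R :> R.
    rewrite -natrM ler_nat.
    by apply: leq_trans (NB k); rewrite /k; clear; lia.
  have [n nE] : exists n, N k = n by exists (N k).
  rewrite nE in Nk1 Nk2 *.
  have n0 : 0 <= n%:R :> R by [].
  have v0 : 0 <= (1 - z) * n%:R by rewrite mulr_ge0//; lra.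
  have /andP[m1 m2] := truncn_itv v0.
  set m := (Num.truncn ((1 - z) * n%:R)).+1 in m2.
  have {}m1 : m%:R <= (1 - z) * n%:R + 1.
    by rewrite /m -natr1; lra.
  have m0 : (0 < m)%N by [].
  move: m m0 m1 m2 => m m0 m1 m2.
  have mn : (m <= n.+1)%N.
    rewrite -(ler_nat R) -natr1; apply: le_trans m1 _.
    have : z * n%:R >= 0 by rewrite mulr_ge0// ltW.
    by lra.
  pose q := ((n.+1 - m) %/ L)%N.
  have qL : (q * L <= n.+1 - m)%N by exact: leq_trunc_div.
  have qL' : (n.+1 - m < q.+1 * L)%N by exact: ltn_ceil.
  move: q qL qL' => q qL qL'.
  apply: (@le_trans _ _ q%:R).
    move: qL'; rewrite -(ltr_nat R) natrM natrB// -natr1 -natr1 => qL'.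
    have -> : z / (2 * L%:R) * n%:R = z * n%:R / (2 * L%:R) by field; lra.
    rewrite ler_pdivrMr ?mulr_gt0//; lra.
  rewrite ler_nat; apply: leq_trans (@count_iota_sub _ m (q * L) n m0 _); last first.
    by clear - qL mn; lia.
  apply: count_iota_blocks => a ma aL; have [x xa xu] := HL a; exists x => //.
  have mx : m%:R <= x%:R :> R by rewrite ler_nat; clear - ma xa; lia.
  have xn : x%:R <= n%:R :> R by rewrite ler_nat; clear - aL xa qL mn; lia.
  apply/asboolP; split=> //.
  + rewrite /posnat/=; clear - ma xa m0; lia.
  + rewrite -(ler_nat R).
    have : (1 - z) * n%:R >= 1 / 2 * n%:R by rewrite ler_wpM2r//; lra.
    lra.
  + by exists k; rewrite /W nE xn andbT; lra.
have core j k : (j <= k)%N -> forall x y, A x -> A y ->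
    W j x -> W k y -> ~ attained gamma g (x + y).
  move=> jk x y [_ Mx xu _] [_ My yu _] /andP[jx xj] /andP[ky yk].
  move=> /(HM0 (x + y)%N (leq_trans Mx (leq_addr _ _))) => ph.
  have [X1k X2k] := NX k; have NSk := NS k.
  have c1 := dist_int_add (x%:R / gamma - u) (y%:R / gamma - u).
  have c2 := dist_int_add (x%:R / gamma - u + (y%:R / gamma - u))
    (- (g (N k)%:R / gamma - tau)).
  rewrite dist_intN in c2.
  have xyE : (x + y)%:R = x%:R + y%:R :> R by rewrite natrD.
  have finish (s' r : R) : 1 / (2 * gamma) + 6 * e <= dist_int s' ->
      `|r| <= gamma * e ->
      phase gamma lambda g (x + y) - s' = (x%:R / gamma - u + (y%:R / gamma - u) -
        (g (N k)%:R / gamma - tau)) - r / gamma -> False.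
    move=> hs hr pE.
    have c3 := dist_int_lipschitz (phase gamma lambda g (x + y) - s')
      (x%:R / gamma - u + (y%:R / gamma - u) - (g (N k)%:R / gamma - tau)).
    rewrite [X in `|X|](_ : _ = - r / gamma) in c3; last by rewrite pE; ring.
    rewrite normrM normrN normfV (gtr0_norm g0) in c3.
    have rg : `|r| / gamma <= e by rewrite ler_pdivrMr// mulrC.
    have := dist_int_add (phase gamma lambda g (x + y))
      (- (phase gamma lambda g (x + y) - s')).
    by rewrite dist_intN opprB addrC subrK; lra.
  move: jk; rewrite leq_eqVlt => /orP[/eqP jk|/Nsparse jk].
    rewrite jk in jx xj.
    apply: (finish (s - d) (g (x + y)%:R - g (N k)%:R - lambda * ln 2) e2).
      apply: HX2 => //; rewrite xyE ler_norml.
      have : 2 * z * (N k)%:R <= z2 * (N k)%:R by rewrite ler_wpM2r.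
      lra.
    by rewrite /phase /s /d xyE; field; lra.
  apply: (finish s (g (x + y)%:R - g (N k)%:R) e1).
    have := HX1 (N k)%:R (x + y)%:R X1k; rewrite ln1 mulr0 subr0 mul1r; apply.
    have : z * (N k)%:R <= z1 * (N k)%:R by rewrite ler_wpM2r.
    have : 0 <= x%:R :> R by [].
    by rewrite xyE ler_norml; lra.
  by rewrite /phase /s xyE; field; lra.
move=> x y Ax Ay; have [_ _ _ [j jx]] := Ax; have [_ _ _ [k ky]] := Ay.
have [jk|/ltnW kj] := leqP j k; first exact: (core j k jk).
by rewrite addnC; exact: (core k j kj).
Qed.

(** * Rational slope *)

Lemma bounded_nonincreasing_int_eventually_constant (e : nat -> int) (N0 : nat)
  (C : int) :
  (forall i j, (N0 <= i <= j)%N -> e j <= e i) ->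
  (forall i, (N0 <= i)%N -> C <= e i) ->
  exists (E : int) (N : nat), forall n, (N <= n)%N -> e n = E.
Proof.
move=> mono bnd; pose P v := `[< exists2 n, (N0 <= n)%N & `|e n - C|%N = v >].
have exP : exists v, P v by exists `|e N0 - C|%N; apply/asboolP; exists N0.
case: (ex_minnP exP) => v /asboolP[n N0n nv] vmin; exists (e n), n => m nm.
have N0m := leq_trans N0n nm.
have := vmin `|e m - C|%N; have -> : P `|e m - C|%N by apply/asboolP; exists m.
move=> /(_ isT).
have := mono n m; rewrite N0n nm => /(_ isT); have := bnd _ N0n.
by have := bnd _ N0m; rewrite -nv; lia.
Qed.

Lemma bounded_monotone_int_eventually_constant (e : nat -> int) (N0 : nat)
  (C : int) :
  (forall i j, (N0 <= i <= j)%N -> e i <= e j) \/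
  (forall i j, (N0 <= i <= j)%N -> e j <= e i) ->
  (forall i, (N0 <= i)%N -> - C <= e i <= C) ->
  exists (E : int) (N : nat), forall n, (N <= n)%N -> e n = E.
Proof.
case=> mono bnd; last first.
  apply: (@bounded_nonincreasing_int_eventually_constant _ N0 (- C)) => //.
  by move=> i /bnd /andP[].
have [||E [N HN]] :=
  @bounded_nonincreasing_int_eventually_constant (fun n => - e n) N0 (- C).
- by move=> i j ij; rewrite lerN2; exact: mono.
- by move=> i /bnd /andP[_]; rewrite lerN2.
- by exists (- E), N => n /HN; lia.
Qed.

(** Rounding [p n / q + g n] is the same as dividing [p n + floor (q (g n + 1/2))] by [q] with
    floor. The inner floor is a bounded monotone sequence of integers, hence eventually a constant
    [E]. *)
Lemma nearest_int_rational_slope (R : realType) (g : R -> R) (p q : nat) (C : R) :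
  (0 < q)%N ->
  (exists X : R, forall x y, X <= x -> x <= y -> g x <= g y) \/
  (exists X : R, forall x y, X <= x -> x <= y -> g y <= g x) ->
  (exists X : R, forall x, X <= x -> `|g x| <= C) ->
  exists (E : int) (N : nat), forall n, (N <= n)%N ->
    nearest_int (p%:R / q%:R * n%:R + g n%:R) = ((p%:Z * n%:Z + E) %/ q%:Z)%Z.
Proof.
move=> q0 mono [X1 HX1]; have q0R : 0 < q%:R :> R by rewrite ltr0n.
pose e (n : nat) : int := Num.floor (q%:R * (g n%:R + 1 / 2)).
pose D : int := Num.floor (q%:R * (`|C| + 1 / 2)) + 1.
have [X bX mX] : exists2 X : R, forall x, X <= x -> `|g x| <= C &
    (forall x y, X <= x -> x <= y -> g x <= g y) \/
    (forall x y, X <= x -> x <= y -> g y <= g x).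
  case: mono => -[X2 HX2]; exists (Num.max X1 X2).
  - by move=> x /ler_max2[/HX1].
  - by left=> x y /ler_max2[_]; exact: HX2.
  - by move=> x /ler_max2[/HX1].
  - by right=> x y /ler_max2[_]; exact: HX2.
have [N HN] := natr_eventually_ge X.
have [||E [N1 HN1]] := @bounded_monotone_int_eventually_constant e N D.
- case: mX => m; [left|right] => i j /andP[Ni ij]; apply: le_floor;
    rewrite ler_pM2l// lerD2r m ?ler_nat//; exact: HN.
- move=> i /HN /bX; rewrite ler_norml => /andP[g1 g2].
  have C1 := ler_norm C.
  have /andP[f1 f2] := floor_itv (q%:R * (`|C| + 1 / 2)).
  rewrite /D; apply/andP; split.
    rewrite /e floor_ge_int intrN.
    have : q%:R * (- (`|C| + 1 / 2)) <= q%:R * (g i%:R + 1 / 2).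
      by rewrite ler_pM2l//; lra.
    by rewrite mulrN; lra.
  apply: ltW; rewrite floor_lt_int; apply: le_lt_trans f2.
  by rewrite ler_pM2l//; lra.
exists E, N1 => n /HN1 en; apply/nearest_intP.
have /andP[f1 f2] := floor_itv (q%:R * (g n%:R + 1 / 2)).
rewrite -/(e n) en intrD in f1 f2.
set m := p%:Z * n%:Z + E; have mE := divz_eq m q%:Z.
have q0Z : q%:Z != 0 by rewrite -lt0n in q0 *; lia.
have m0 := modz_ge0 m q0Z; have mq := ltz_mod m q0Z.
move: mE m0 mq; set k := (m %/ q%:Z)%Z; set r := (m %% q%:Z)%Z => mE r0 rq.
have {}mE : p%:R * n%:R + E%:~R = k%:~R * q%:R + r%:~R :> R.
  have : m%:~R = (k * q%:Z + r)%:~R :> R by rewrite -mE.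
  by rewrite /m !intrD !intrM.
have {}r0 : 0 <= r%:~R :> R by rewrite ler0z.
have {}rq : r%:~R + 1 <= q%:R :> R.
  by rewrite -[1]/(1%:~R) -intrD -[q%:R]/(q%:Z%:~R) ler_int; lia.
have e1 : p%:R / q%:R * n%:R + g n%:R + 1 / 2 =
  (k%:~R * q%:R + r%:~R - E%:~R + q%:R * (g n%:R + 1 / 2)) / q%:R.
  by rewrite -mE; field; lra.
have h1 : k%:~R <= p%:R / q%:R * n%:R + g n%:R + 1 / 2.
  by rewrite e1 ler_pdivlMr//; lra.
have h2 : p%:R / q%:R * n%:R + g n%:R + 1 / 2 < k%:~R + 1.
  by rewrite e1 ltr_pdivrMr// mulrDl mul1r; lra.
by apply/andP; split; lra.
Qed.

(** [m] is the quotient of [p n + E] by [q] exactly when [E - q m = r - p n] with [0 <= r < q], and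
    [q < p] makes [r] the residue modulo [p]. *)
Lemma attained_rational_slope (R : realType) (g : R -> R) (p q : nat) (E : int)
  (N : nat) :
  (0 < q < p)%N ->
  (forall n, (N <= n)%N -> nearest_int (p%:R / q%:R * n%:R + g n%:R) =
    ((p%:Z * n%:Z + E) %/ q%:Z)%Z) ->
  exists M : nat, forall m, (M <= m)%N ->
    attained (p%:R / q%:R) g m <-> ((E - q%:Z * m%:Z) %% p%:Z)%Z < q%:Z.
Proof.
move=> /andP[q0 qp] aE.
have q0Z : q%:Z != 0 by lia. have p0Z : p%:Z != 0 by lia.
have [C HC] := bounded_prefix (fun n => p%:R / q%:R * n%:R + g n%:R) N.
exists (C + 1 + `|E| + p * N.+1)%N => m Mm; split=> [[n _ nE]|].
  have Nn : (N <= n)%N.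
    rewrite leqNgt; apply/negP => /HC.
    have /andP[+ _] := nearest_int_itv (p%:R / q%:R * n%:R + g n%:R).
    rewrite nE -[m%:Z%:~R]/(m%:R).
    have : C%:R + 1 <= m%:R :> R by rewrite natr1 ler_nat; clear - Mm; lia.
    lra.
  rewrite (aE _ Nn) in nE; have := divz_eq (p%:Z * n%:Z + E) q%:Z.
  have := modz_ge0 (p%:Z * n%:Z + E) q0Z; have := ltz_mod (p%:Z * n%:Z + E) q0Z.
  rewrite nE; move: (_ %% _)%Z => r r2 r1 rE.
  have -> : E - q%:Z * m%:Z = (- n%:Z) * p%:Z + r by clear - rE; lia.
  by rewrite modzMDl modz_small//; clear - r1 r2 qp; lia.
have := divz_eq (E - q%:Z * m%:Z) p%:Z; have := modz_ge0 (E - q%:Z * m%:Z) p0Z.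
move: (_ %% _)%Z (_ %/ _)%Z => r c r0 rE rq.
have Nc : N.+1%:Z <= - c.
  rewrite -(@ler_pM2l _ p%:Z); last by clear - qp; lia.
  have e1 : p%:Z * (- c) = q%:Z * m%:Z + r - E by clear - rE; lia.
  rewrite e1; have : m%:Z <= q%:Z * m%:Z.
    by rewrite ler_peMl//; clear - q0; lia.
  have : (p * N.+1)%N%:Z = p%:Z * N.+1%:Z by rewrite PoszM.
  by clear - Mm r0; lia.
have cE : - c = `|c|%N%:Z by clear - Nc; lia.
exists `|c|%N; first by rewrite /posnat/=; clear - Nc; lia.
rewrite aE; last by clear - Nc cE; lia.
have -> : p%:Z * `|c|%N%:Z + E = m%:Z * q%:Z + r.
  by rewrite -cE; clear - rE; lia.
by rewrite divzMDl// divz_small ?addr0//; clear - r0 rq; lia.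
Qed.

Lemma residue_class_upper_density (R : realType) (p u M : nat) : (0 < p)%N ->
  (0 < upper_density R [set x | [/\ posnat x, (M <= x)%N & x = u %[mod p]]])%E.
Proof.
move=> p0; apply/upper_density_gt0; exists (1 / (2 * p%:R)).
  by rewrite divr_gt0// mulr_gt0// ltr0n.
move=> N0; pose N := (N0 + 2 * (M + p)).+1; exists N; first by rewrite /N; lia.
pose q := ((N - M) %/ p)%N.
have qp : (q * p <= N - M)%N by exact: leq_trunc_div.
have qp' : (N - M < q.+1 * p)%N by exact: ltn_ceil.
have MN : (2 * (M + p) <= N)%N by rewrite /N; clear; lia.
move: N q qp qp' MN => N q qp qp' MN.
have p0R : 0 < p%:R :> R by rewrite ltr0n.
apply: (@le_trans _ _ q%:R).
  rewrite mul1r ler_pdivrMl ?mulr_gt0//.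
  move: qp'; rewrite -(ltr_nat R) natrM natrB; last by clear - MN; lia.
  by move: MN; rewrite -(ler_nat R) natrM natrD -natr1; lra.
rewrite ler_nat; apply: leq_trans (@count_iota_sub _ M.+1 (q * p) N isT _);
  last by clear - qp MN; lia.
(* [(p - 1) * a] plays the part of [- a] modulo [p]. *)
apply: count_iota_blocks => a Ma _; exists (a + (u + (p - 1) * a) %% p)%N.
  by rewrite leq_addr ltn_add2l ltn_pmod.
apply/asboolP; split; rewrite /posnat/=.
- by apply: leq_trans (leq_addr _ _); exact: leq_trans Ma.
- by apply: leq_trans (leq_addr _ _); exact: ltnW.
- rewrite modnDmr addnCA -mulSn subn1 prednK// [(p * a)%N]mulnC.
  by rewrite addnC modnMDl.
Qed.

(** Since [q] is invertible modulo [p], every residue [j] congruent to [E - 2 f] for some [f] occurs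
    and must be below [q]. For odd [p] this would include [j = q]. For even [p] these are the
    residues with the parity of [E]: odd [E] would give [p - 1 < q], and even [E] gives
    [p - 2 < q]. *)
Lemma all_double_residues (p q : nat) (E : int) : (0 < q < p)%N -> coprime p q ->
  (forall u : nat, ((E - q%:Z * (2 * u)%N%:Z) %% p%:Z)%Z < q%:Z) ->
  [/\ p = q.+1, odd q & (E %% 2)%Z = 0].
Proof.
move=> /andP[q0 qp] pq hu.
have p0Z : p%:Z != 0 by lia.
have small (j f t : int) : 0 <= j < p%:Z -> 2 * f = E - j + t * p%:Z -> j < q%:Z.
  move=> jp fE; have /coprimezP[[a b]/= ab] : coprimez p%:Z q%:Z by exact: pq.
  have := divz_eq (b * f) p%:Z; have := modz_ge0 (b * f) p0Z.
  move: (_ %% _)%Z (_ %/ _)%Z => w c w0 bfE.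
  have wE : w = `|w|%N by clear - w0; lia.
  have := hu `|w|%N; rewrite PoszM -wE.
  have key : E - q%:Z * (2 * w) =
      (2 * q%:Z * c + 2 * a * f - t) * p%:Z + j.
    have -> : w = b * f - c * p%:Z by rewrite bfE addrC addKr.
    have -> : E = 2 * f + j - t * p%:Z by rewrite fE; ring.
    have -> : 2 * f = 2 * f * (a * p%:Z + b * q%:Z) by rewrite ab mulr1.
    by ring.
  by rewrite key modzMDl modz_small.
have podd : ~~ odd p.
  apply/negP => op; have [dv|ndv] := boolP (2 %| E - q%:Z)%Z.
    have /dvdzP[f fE] := dv.
    have := small q%:Z f 0 ltac:(lia) ltac:(rewrite mul0r addr0 fE mulrC//).
    by rewrite ltxx.
  have := small q%:Z ((E - q%:Z + p%:Z) %/ 2)%Z 1 ltac:(lia) ltac:(lia).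
  by rewrite ltxx.
have qodd : odd q.
  apply: contraLR pq => qe; rewrite /coprime; apply/negP => /eqP g1.
  have : (2 %| gcdn p q)%N by rewrite dvdn_gcd !dvdn2 podd qe.
  by rewrite g1.
have [Ee|Eo] : (E %% 2)%Z = 0 \/ (E %% 2)%Z = 1 by lia.
  have := small (p%:Z - 2) ((E - (p%:Z - 2)) %/ 2)%Z 0.
  by rewrite mul0r addr0 => h; split=> //; lia.
have := small (p%:Z - 1) ((E - (p%:Z - 1)) %/ 2)%Z 0.
by rewrite mul0r addr0 => h; lia.
Qed.

(** For odd [q] the floor of [k / q] is the nearest integer to [(k - (q - 1) / 2) / q]. This is how
    [a = q] and [c = E - q./2] in (b) arise. *)
Lemma nearest_int_shifted_slope (R : realType) (q n : nat) (E : int) : odd q ->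
  ((q.+1%:Z * n%:Z + E) %/ q%:Z)%Z =
  n%:Z + nearest_int ((n%:Z + (E - q./2%:Z))%:~R / q%:R : R).
Proof.
move=> oq; have q0 : (0 < q)%N by case: q oq.
have qE : q%:Z = 2 * q./2%:Z + 1 by have := odd_double_half q; rewrite oq; lia.
have q0Z : q%:Z != 0 by lia. have q0R : 0 < q%:R :> R by rewrite ltr0n.
have -> : q.+1%:Z * n%:Z + E = n%:Z * q%:Z + (n%:Z + E) by lia.
rewrite divzMDl//; congr (_ + _); apply/esym/nearest_intP.
have := divz_eq (n%:Z + E) q%:Z; have := modz_ge0 (n%:Z + E) q0Z.
have := ltz_mod (n%:Z + E) q0Z; move: (_ %/ _)%Z (_ %% _)%Z => k r rq r0 rE.
have qR : q%:R = 2 * q./2%:R + 1 :> R.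
  by rewrite -[q%:R]/(q%:Z%:~R) qE intrD intrM.
have {}rE : (n%:Z + (E - q./2%:Z))%:~R = k%:~R * q%:R + r%:~R - q./2%:R :> R.
  by rewrite addrA intrB rE intrD intrM.
have r0R : 0 <= r%:~R :> R by rewrite ler0z.
have rqR : r%:~R + 1 <= q%:R :> R.
  by rewrite -[1]/(1%:~R) -intrD -[q%:R]/(q%:Z%:~R) ler_int; lia.
rewrite rE ler_pdivlMr// ltr_pdivrMr// mulrBl mulrDl.
by apply/andP; split; lra.
Qed.

(** The hypothesis on dense sets is tested on the far part of the class of [u] modulo [p], where all
    sums are congruent to [2 u]. *)
Lemma rational_slope_attained (R : realType) (g : R -> R) (p q : nat) (C : R) :
  (0 < q < p)%N -> coprime p q ->
  (exists X : R, forall x y, X <= x -> x <= y -> g x <= g y) \/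
  (exists X : R, forall x y, X <= x -> x <= y -> g y <= g x) ->
  (exists X : R, forall x, X <= x -> `|g x| <= C) ->
  (forall A : set nat, A `<=` posnat -> (0 < upper_density R A)%E ->
     exists x y : nat, [/\ A x, A y & attained (p%:R / q%:R) g (x + y)]) ->
  exists (a : nat) (c : int), [/\ odd a,
    exists N : nat, forall n, (N <= n)%N ->
      nearest_int (p%:R / q%:R * n%:R + g n%:R) =
        n%:Z + nearest_int ((n%:Z + c)%:~R / a%:R : R) &
    exists M : nat, forall m, (M <= m)%N -> ~~ odd m ->
      attained (p%:R / q%:R) g m].
Proof.
move=> qp cop mono bnd dens; have /andP[q0 q_p] := qp.
have [E [N aE]] := nearest_int_rational_slope p q0 mono bnd.
have [M HM] := attained_rational_slope qp aE.
have p0 : (0 < p)%N by apply: ltn_trans q_p.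
have [|pE oq E2] := @all_double_residues p q E qp cop.
  move=> u; have [||x [y [[_ Mx xu] [_ _ yu]]]] :=
    dens [set x | [/\ posnat x, (M <= x)%N & x = u %[mod p]]].
  - by move=> x [].
  - exact: residue_class_upper_density.
  move=> /(HM (x + y)%N (leq_trans Mx (leq_addr _ _))).
  have : (x + y = 2 * u %[mod p])%N by rewrite -modnDm xu yu modnDm mul2n addnn.
  have natE z : z%:Z = (z %/ p)%N%:Z * p%:Z + (z %% p)%N%:Z.
    by rewrite -PoszM -PoszD -divn_eq.
  move=> e; rewrite (natE (x + y)%N) (natE (2 * u)%N) e.
  have red k : E - q%:Z * (k * p%:Z + (2 * u %% p)%N%:Z) =
    (- (q%:Z * k)) * p%:Z + (E - q%:Z * (2 * u %% p)%N%:Z) by ring.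
  by rewrite !red !modzMDl.
exists q, (E - q./2%:Z); split=> //.
  by exists N => n /aE ->; rewrite pE (nearest_int_shifted_slope R).
exists M => m /HM -> em.
have p0Z : p%:Z != 0 by lia.
have := divz_eq (E - q%:Z * m%:Z) p%:Z; have := ltz_mod (E - q%:Z * m%:Z) p0Z.
move: (_ %% _)%Z (_ %/ _)%Z => r c rp rE.
have [m' mE] : exists m', m = (2 * m')%N.
  by exists m./2; rewrite -[LHS]odd_double_half (negbTE em) add0n mul2n.
have [q' qE'] : exists q', q = (2 * q').+1.
  by exists q./2; rewrite -[LHS]odd_double_half oq mul2n.
have [E' EE] : exists E' : int, E = 2 * E' by exists (E %/ 2)%Z; lia.
(* The residue [r] is even and smaller than the even number [p = q + 1], hence smaller than [q]. *)
have rE' : r = 2 * (E' - q%:Z * m'%:Z - c * (q'%:Z + 1)).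
  have -> : r = E - q%:Z * m%:Z - c * p%:Z by rewrite rE addrC addKr.
  by rewrite EE mE pE qE'; clear; lia.
move: rE'; move: (_ - _ - _) => v rE'.
by clear - rE' rp pE qE'; lia.
Qed.

(** * Bounded and divergent remainders *)

Lemma monotone_bounded_limit (R : realType) (g : R -> R) (C : R) :
  (exists X : R, forall x y, X <= x -> x <= y -> g x <= g y) \/
  (exists X : R, forall x y, X <= x -> x <= y -> g y <= g x) ->
  (exists X : R, forall x, X <= x -> `|g x| <= C) ->
  exists l : R, forall e : R, 0 < e -> exists X : R, forall x, X <= x ->
    `|g x - l| < e.
Proof.
have pos (h : R -> R) : (exists X : R, forall x y, X <= x -> x <= y -> h x <= h y) ->
    (exists X : R, forall x, X <= x -> `|h x| <= C) ->
    exists l : R, forall e : R, 0 < e -> exists X : R, forall x, X <= x ->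
    `|h x - l| < e.
  move=> [X1 mono] [X2 bnd]; pose X := Num.max X1 X2.
  pose S : set R := [set h x | x in [set x | X <= x]].
  have ubS : ubound S C.
    by move=> _ [x /= /ler_max2[_ /bnd] + <-]; rewrite ler_norml => /andP[].
  have supS : has_sup S.
    by split; [exists (h X), X => //=; exact: lexx|exists C].
  exists (sup S) => e e0; have [_ [x0 /= Xx0 <-] hx0] := sup_adherent e0 supS.
  exists x0 => x x0x; have [X1x0 _] := ler_max2 Xx0.
  have h1 := mono _ _ X1x0 x0x.
  have h2 : h x <= sup S.
    by apply: sup_ubound; [exists C|exists x => //=; exact: le_trans x0x].
  by rewrite ltr_norml; lra.
case=> mono bnd; first exact: pos.
have [||l hl] := pos (fun x => - g x).
- by have [X HX] := mono; exists X => x y Xx xy; rewrite lerN2 HX.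
- by have [X HX] := bnd; exists X => x /HX; rewrite normrN.
exists (- l) => e /hl[X HX]; exists X => x /HX.
by rewrite -opprD normrN opprK.
Qed.

Lemma monotone_unbounded_diverges (R : realType) (g : R -> R) :
  (exists X : R, forall x y, X <= x -> x <= y -> g x <= g y) \/
  (exists X : R, forall x y, X <= x -> x <= y -> g y <= g x) ->
  ~ (exists C X : R, forall x, X <= x -> `|g x| <= C) ->
  (forall T : R, exists X : R, forall x, X <= x -> T < g x) \/
  (forall T : R, exists X : R, forall x, X <= x -> T < - g x).
Proof.
have pos (h : R -> R) : (exists X : R, forall x y, X <= x -> x <= y -> h x <= h y) ->
    ~ (exists C X : R, forall x, X <= x -> `|h x| <= C) ->
    forall T : R, exists X : R, forall x, X <= x -> T < h x.
  move=> [X mono] unb T; pose C := Num.max T `|h X|.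
  have [x [Xx hx]] : exists x, X <= x /\ C < `|h x|.
    apply: contrapT => none; apply: unb; exists C, X => x Xx.
    by rewrite leNgt; apply/negP => hx; apply: none; exists x.
  exists x => y xy; apply: lt_le_trans (mono _ _ Xx xy).
  have hX := mono _ _ (lexx X) Xx; move: hx; rewrite gt_max => /andP[Th hXx].
  have h1 := ler_norm (- h X); rewrite normrN in h1.
  have [h0|h0] := leP 0 (h x); first by rewrite ger0_norm in Th.
  by move: hXx; rewrite (ltr0_norm h0); lra.
case=> mono unb; [left; exact: pos|right; apply: (pos (fun x => - g x))].
  by have [X HX] := mono; exists X => x y Xx xy; rewrite lerN2 HX.
move=> [C [X HX]]; apply: unb; exists C, X => x /HX.
by rewrite normrN.
Qed.

Lemma log_slope_bounded (R : realType) (g : R -> R) (lambda C : R) :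
  log_slope g lambda -> (exists X : R, forall x, X <= x -> `|g x| <= C) ->
  lambda = 0.
Proof.
move=> slope [X1 HX1]; apply/eqP; apply: contrapT => /negP l0.
have l1 : 0 < `|lambda| by rewrite normr_gt0.
have l2 : 0 < `|lambda| / 2 by lra.
have [X2 X20 HX2] := slope _ l2; pose x := Num.max X1 X2.
have [X1x X2x] : X1 <= x /\ X2 <= x by apply: ler_max2; exact: lexx.
have x0 : 0 < x by lra.
have C0 : 0 <= C by apply: le_trans (HX1 _ X1x).
(* Over a logarithmic length [t], [g] changes by at least [|lambda| / 2 * t], which exceeds
   [2 * C]. *)
pose t := 4 * C / `|lambda| + 1.
have t0 : 0 < t by rewrite ltr_pwDr// divr_ge0// mulr_ge0.
pose y := x * expR t.
have et : 1 <= expR t by rewrite -expR0 ler_expR ltW.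
have xy : x <= y by rewrite /y ler_peMr// ltW.
have ln_y : ln y - ln x = t.
  by rewrite /y lnM ?posrE ?expR_gt0// expRK addrC addKr.
have := HX2 _ _ X2x xy; rewrite ln_y => h.
have h1 := HX1 _ X1x; have h2 := HX1 _ (le_trans X1x xy).
have h3 := ler_normB (g y) (g x).
have := lerB_dist (lambda * t) (g y - g x).
rewrite (distrC (lambda * t)) normrM (gtr0_norm t0).
have lt : `|lambda| * t = 4 * C + `|lambda| by rewrite /t; field; lra.
lra.
Qed.

(** Boundedness forces [lambda = 0], so the two phases coincide. As [g] converges, [tau] is imposed,
    but irrationality leaves the centre [u] of the Bohr set free; it is chosen to put the common
    phase at [1/2]. *)
Lemma irrational_slope_sums_missed (R : realType) (g : R -> R) (lambda gamma C : R) :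
  log_slope g lambda -> 1 < gamma ->
  (forall p q : nat, (0 < q)%N -> gamma <> p%:R / q%:R) ->
  (exists X : R, forall x y, X <= x -> x <= y -> g x <= g y) \/
  (exists X : R, forall x y, X <= x -> x <= y -> g y <= g x) ->
  (exists X : R, forall x, X <= x -> `|g x| <= C) ->
  exists A : set nat, [/\ A `<=` posnat, (0 < upper_density R A)%E &
    forall x y, A x -> A y -> ~ attained gamma g (x + y)].
Proof.
move=> slope g1 irr mono bnd; have g0 : 0 < gamma by lra.
have lam0 := log_slope_bounded slope bnd.
have [l hl] := monotone_bounded_limit mono bnd.
have s2 : 1 / (2 * gamma) < dist_int (1 / 2 : R).
  rewrite dist_int_small ger0_norm//; rewrite ltr_pdivrMr ?mulr_gt0//; lra.
pose u := (1 / 2 + l / gamma - lambda * ln gamma / gamma) / 2.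
apply: (@sums_missed_of_phases _ g lambda gamma u (l / gamma)) => //.
- move=> e M e0; have ge0 : 0 < gamma * e by rewrite mulr_gt0.
  have [X HX] := hl _ ge0; have [N HN] := natr_eventually_ge X.
  exists (M + N)%N; first by rewrite leq_addr.
  apply: le_lt_trans (dist_int_norm _) _.
  rewrite -mulrBl normrM normfV (gtr0_norm g0) ltr_pdivrMr// mulrC.
  by apply/HX/HN; rewrite leq_addl.
- move=> e e0; apply: (bohr_syndetic (theta := gamma^-1)) => //; right=> q q0.
  apply/eqP => /dist_int_eq0[k kE].
  have q0R : 0 < q%:R :> R by rewrite ltr0n.
  have k0 : 0 < k by rewrite -(ltr_int R) -kE divr_gt0.
  have kn : k%:~R = `|k|%N%:R :> R.
    by rewrite -[_%:R]/(`|k|%N%:Z%:~R); congr intr; clear - k0; lia.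
  apply: (irr q `|k|%N); first by clear - k0; lia.
  by rewrite -kn -kE; field; lra.
- by have -> : 2 * u - l / gamma + lambda * ln gamma / gamma = 1 / 2
    by rewrite /u; field; lra.
- by have -> : 2 * u - l / gamma + lambda * ln gamma / gamma -
    lambda * ln 2 / gamma = 1 / 2 by rewrite /u lam0; field; lra.
Qed.

(** Here [gamma] may be rational, so the Bohr set is centred at [0]. The freedom lies in [tau]
    instead: [g / gamma] diverges with vanishing steps and comes close to any prescribed value
    modulo [1]. *)
Lemma divergent_sums_missed (R : realType) (g : R -> R) (lambda gamma : R) :
  log_slope g lambda -> 1 < gamma ->
  dist_int (lambda * ln 2 / gamma) < 1 - 1 / gamma ->
  (forall T : R, exists X : R, forall x, X <= x -> T < g x) \/
  (forall T : R, exists X : R, forall x, X <= x -> T < - g x) ->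
  exists A : set nat, [/\ A `<=` posnat, (0 < upper_density R A)%E &
    forall x y, A x -> A y -> ~ attained gamma g (x + y)].
Proof.
move=> slope g1 /dist_int_separated[s [s1 s2]] div; have g0 : 0 < gamma by lra.
have gE : 1 / 2 - (1 - 1 / gamma) / 2 = 1 / (2 * gamma) by field; lra.
rewrite gE in s1 s2.
pose tau := lambda * ln gamma / gamma - s.
have sE : 2 * 0 - tau + lambda * ln gamma / gamma = s by rewrite /tau; ring.
apply: (@sums_missed_of_phases _ g lambda gamma 0 tau) => //; rewrite ?sE//.
  move=> e M e0.
  have slow b : `|b| = 1 -> forall e : R, 0 < e -> exists N : nat, forall n,
      (N <= n)%N -> `|b * g n.+1%:R / gamma - b * g n%:R / gamma| < e.
    move=> b1 {M e0}e e0; have ge0 : 0 < gamma * e / 2.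
      by rewrite divr_gt0// mulr_gt0.
    have [X X0 HX] := log_slope_small_step 1 slope ge0.
    have [N HN] := natr_eventually_ge X; exists N => n /HN Xn.
    rewrite -mulrBl -mulrBr !normrM b1 mul1r normfV (gtr0_norm g0).
    rewrite ltr_pdivrMr//; apply: le_lt_trans (HX _ _ Xn _) _.
      by rewrite -natr1 addrAC subrr add0r normr1.
    by rewrite [e * _]mulrC gtr_pMr ?mulr_gt0//; lra.
  have unb b : (forall T : R, exists X : R, forall x, X <= x -> T < b * g x) ->
      forall (T : R) (N : nat), exists2 n : nat, (N <= n)%N & T <= b * g n%:R / gamma.
    move=> hb T N; have [X HX] := hb (T * gamma).
    have [N' HN'] := natr_eventually_ge X; exists (N + N')%N.
      by rewrite leq_addr.
    by rewrite ler_pdivlMr//; apply/ltW/HX/HN'; rewrite leq_addl.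
  case: div => div.
    have [|N MN Ne] := slow_sequence_dense tau M (slow 1 (normr1 _)) _ e0.
      by apply: unb => T; have [X HX] := div T; exists X => x /HX; rewrite mul1r.
    by exists N => //; rewrite mul1r in Ne.
  have [|N MN Ne] := slow_sequence_dense (- tau) M (slow (-1) (normrN1 _)) _ e0.
    by apply: unb => T; have [X HX] := div T; exists X => x /HX; rewrite mulN1r.
  exists N => //; rewrite -dist_intN; apply: le_lt_trans Ne.
  by rewrite mulN1r mulNr opprD.
by move=> e e0; apply: (bohr_syndetic (theta := gamma^-1)) => //; left.
Qed.

(** * The equivalence *)

Lemma dense_set_unbounded (R : realType) (A : set nat) (M : nat) :
  (0 < upper_density R A)%E -> exists2 x : nat, (M <= x)%N & A x.
Proof.
by move=> /upper_density_gt0_common_difference[h _ /(_ M)[x Mx [Ax _]]]; exists x.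
Qed.

Lemma rational_or_not (R : realType) (gamma : R) : 1 < gamma ->
  (exists p q : nat, [/\ (0 < q < p)%N, coprime p q & gamma = p%:R / q%:R]) \/
  (forall p q : nat, (0 < q)%N -> gamma <> p%:R / q%:R).
Proof.
move=> g1; have [[p [q [q0 gE]]]|irr] :=
    pselect (exists p q : nat, (0 < q)%N /\ gamma = p%:R / q%:R); last first.
  by right=> p q q0 gE; apply: irr; exists p, q.
left; pose d := gcdn p q; have d0 : (0 < d)%N by rewrite gcdn_gt0 q0 orbT.
have pE : (p = p %/ d * d)%N by rewrite divnK// dvdn_gcdl.
have qE : (q = q %/ d * d)%N by rewrite divnK// dvdn_gcdr.
have d0R : d%:R != 0 :> R by rewrite pnatr_eq0 -lt0n.
have q1 : (0 < q %/ d)%N by rewrite divn_gt0// dvdn_leq// dvdn_gcdr.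
have q1R : 0 < (q %/ d)%:R :> R by rewrite ltr0n.
have gE' : gamma = (p %/ d)%:R / (q %/ d)%:R.
  by rewrite gE {1}pE {1}qE !natrM invfM mulrACA divff// mulr1.
exists (p %/ d)%N, (q %/ d)%N; split=> //.
  by rewrite q1 -(ltr_nat R) -[ltLHS]mul1r -ltr_pdivlMr// -gE'.
rewrite /coprime -(eqn_pmul2r d0) mul1n muln_gcdl -pE -qE.
by [].
Qed.

Theorem theorem7p3 (R : realType) (alpha r1 : R -> R) (gamma lambda : R)
  (alpha_subpoly : sub_polynomial alpha)
  (alpha_infty : alpha x @[x --> +oo] --> +oo)
  (gamma_ge0 : 0 <= gamma)
  (alphaE : \forall x \near +oo, alpha x = gamma * x + lambda * ln x + r1 x)
  (r1_small : `|r1 x| / ln x @[x --> +oo] --> 0) :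
  (forall A : set nat, A `<=` posnat -> (0 < upper_density R A)%E ->
    exists x y n : nat, [/\ A x, A y, posnat n &
      (x + y)%:Z = nearest_int (alpha n%:R)])
  <->
  [\/ gamma <= 1,
      exists (a : nat) (c : int), [/\ odd a,
        \forall n \near \oo, nearest_int (alpha n%:R) =
          n%:Z + nearest_int ((n%:Z + c)%:~R / a%:R : R) &
        finite_set [set m : nat | [/\ posnat m,
          ~ (exists2 n : nat, posnat n & nearest_int (alpha n%:R) = m%:Z) &
          ~~ odd m]]]
    | [/\ `|lambda * ln x + r1 x| @[x --> +oo] --> +oo,
          1 < gamma <= 2 &
          1 - 1 / gamma <= dist_int (lambda * ln 2 / gamma)] ].

Proof.
pose g x := alpha x - gamma * x.
have slope : log_slope g lambda := hardy_log_slope alpha_subpoly alphaE r1_small.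
have mono := hardy_sub_linear_monotone gamma alpha_subpoly; rewrite -/g in mono.
have aE n : alpha n%:R = gamma * n%:R + g n%:R by rewrite /g; ring.
have infty C : exists N : nat, forall n, (N <= n)%N -> C <= gamma * n%:R + g n%:R.
  move/cvgryPge: alpha_infty => /(_ C) /near_pinftyP[X HX].
  by have [N HN] := natr_eventually_ge X; exists N => n /HN /HX; rewrite aE.
have gE : \forall x \near +oo, g x = lambda * ln x + r1 x.
  by apply: filterS alphaE => x; rewrite /g => ->; ring.
have attE m : attained gamma g m <->
    exists2 n : nat, posnat n & nearest_int (alpha n%:R) = m%:Z.
  by split=> -[n n0 nE]; exists n => //; rewrite -nE aE.
have sumE A : (exists x y : nat, [/\ A x, A y & attained gamma g (x + y)]) <->
    exists x y n : nat, [/\ A x, A y, posnat n &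
      (x + y)%:Z = nearest_int (alpha n%:R)].
  split=> [[x [y [Ax Ay /attE[n n0 nE]]]]|[x [y [n [Ax Ay n0 nE]]]]].
    by exists x, y, n.
  by exists x, y; split=> //; apply/attE; exists n.
split=> [dens|].
  have {}dens A : A `<=` posnat -> (0 < upper_density R A)%E ->
    exists x y : nat, [/\ A x, A y & attained gamma g (x + y)].
    by move=> A0 Ad; apply/sumE/dens.
  have refute : (exists A : set nat, [/\ A `<=` posnat, (0 < upper_density R A)%E &
      forall x y, A x -> A y -> ~ attained gamma g (x + y)]) -> False.
    move=> [A [A0 Ad miss]]; have [x [y [Ax Ay]]] := dens A A0 Ad.
    exact: miss.
  have [g1|g1] := leP gamma 1; first exact: Or31.
  have [[C bnd]|unb] := pselect (exists C X : R, forall x, X <= x -> `|g x| <= C).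
    have [[p [q [qp pq gpq]]]|irr] := rational_or_not g1; last first.
      by exfalso; apply: refute;
        exact: (irrational_slope_sums_missed slope g1 irr mono bnd).
    move: dens; rewrite gpq => /(rational_slope_attained qp pq mono bnd).
    move=> [a [c [oa [N HN] [M HM]]]]; apply: Or32; exists a, c; split=> //.
      by exists N => // n /= Nn; rewrite aE gpq; exact: HN.
    apply: (@sub_finite_set _ _ `I_M); last exact: finite_II.
    move=> m [m0 miss em] /=; rewrite ltnNge; apply/negP => Mm; apply: miss.
    by apply/attE; rewrite gpq; exact: HM.
  have div := monotone_unbounded_diverges mono unb.
  have [far|near] := leP (1 - 1 / gamma) (dist_int (lambda * ln 2 / gamma)); last first.
    by exfalso; apply: refute; exact: (divergent_sums_missed slope g1 near div).
  apply: Or33; split=> //.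
    apply/cvgryPge => T; case: div => /(_ T) [X HX];
      apply: filterS2 gE (iffRL (near_pinftyP _) (ex_intro _ X HX)) => x <- h.
      exact: le_trans (ltW h) (ler_norm _).
    by rewrite -normrN; exact: le_trans (ltW h) (ler_norm _).
  (* A distance to the integers is at most [1/2], so [1 - 1 / gamma <= 1/2], that is,
     [gamma <= 2]. *)
  rewrite /=; have h := dist_int_le_half (lambda * ln 2 / gamma).
  have : 1 / 2 <= 1 / gamma by lra.
  by rewrite ler_pdivlMr; lra.
move=> cases A A0 Ad; apply/sumE; case: cases.
- move=> g1; apply: (slope_le1_sums_attained slope _ mono infty Ad).
  by rewrite gamma_ge0.
- move=> [a [c [oa _ fin]]].
  have [M HM] : exists M : nat, forall m, (M <= m)%N -> posnat m -> ~~ odd m ->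
      attained gamma g m.
    have /finite_fsetP[F FE] := fin.
    exists (\max_(i <- enum_fset F) i).+1 => m Mm m0 em.
    apply/attE; apply: contrapT => miss.
    have : [set` F] m by rewrite -FE.
    move=> /= mF; suff : (m <= \max_(i <- enum_fset F) i)%N by rewrite leqNgt Mm.
    exact: (@leq_bigmax_seq _ _ predT id).
  (* The sum [x + x] is even and lies beyond the finitely many missed even integers. *)
  have [x Mx Ax] := dense_set_unbounded M Ad.
  exists x, x; split=> //; apply: HM.
  + exact: leq_trans Mx (leq_addr _ _).
  + by have := A0 _ Ax; rewrite /posnat/= addn_gt0 => ->.
  + by rewrite addnn odd_double.
- by move=> [_ /andP[g1 _] far]; exact: (log_slope_sums_attained slope g1 far Ad).
Qed.
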